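(* Let $H$ be a matching covered, uniformable hypergraph, and let $H_1,\ldots,H_p$ and $H'_1,\ldots,H'_q$ be the outputs of any two runs of the tight cut decomposition procedure on $H$. Then the two lists agree up to parallel edges: $p=q$ and there is a bijection $\phi:\{1,\ldots,p\}\to\{1,\ldots,q\}$ such that for every $s$ the hypergraphs $H_s$ and $H'_{\phi(s)}$ are isomorphic up to parallel edges.
   Context: A hypergraph $H$ has a finite vertex set $V(H)$ and a finite family $E(H)$ of non-empty subsets of $V(H)$, called edges; distinct members of the family consisting of the same vertices are called parallel edges and are allowed. A perfect matching of $H$ is a set $M$ of edges such that every vertex of $H$ lies in exactly one edge of $M$. $H$ is matching covered if it is connected, $|E(H)|\geq 1$, and every edge lies in a perfect matching. $H$ is uniformable if there are $m:V(H)\to\mathbb{Z}_{\geq 1}$ and $r\in\mathbb{Z}$ with $\sum_{v\in e}m(v)=r$ for all $e\in E(H)$. For $S\subseteq V(H)$ put $\overline{S}=V(H)\setminus S$, and let $\delta_H(S)$ be the family of edges meeting both $S$ and $\overline S$. The cut $\delta_H(S)$ is tight if $|M\cap\delta_H(S)|=1$ for every perfect matching $M$ of $H$; it is trivial if $|S|=1$ or $|\overline S|=1$, and non-trivial otherwise. Tight cut contractions: let $\delta_H(S)$ be a tight cut and let $s,\overline s\notin V(H)$ be new vertices. For $e\in\delta_H(S)$ put $e_s=(e\setminus S)\cup\{s\}$ and $e_{\overline s}=(e\cap S)\cup\{\overline s\}$. Then $H_S$ has vertex set $\{s\}\cup\overline S$ and edges $\{e\in E(H): e\subseteq\overline S\}\cup\{e_s:e\in\delta_H(S)\}$,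 and $H_{\overline S}$ has vertex set $\{\overline s\}\cup S$ and edges $\{e\in E(H):e\subseteq S\}\cup\{e_{\overline s}:e\in\delta_H(S)\}$ (each $e\in\delta_H(S)$ gives its own edge, so parallel edges may arise). Tight cut decomposition procedure: start with the list consisting of $H$ alone. While some hypergraph $H_j$ in the list has a non-trivial tight cut, choose any such $H_j$ and any $S\subseteq V(H_j)$ defining a non-trivial tight cut of $H_j$, and replace $H_j$ in the list by the two hypergraphs $(H_j)_S$ and $(H_j)_{\overline S}$. The procedure terminates when no hypergraph in the list has a non-trivial tight cut, and outputs the list. Two hypergraphs are isomorphic up to parallel edges if they become isomorphic after keeping only one edge from each class of parallel edges. *)

(* Defs.v *)
From mathcomp Require Import all_boot all_order all_algebra.
From Stdlib Require Import Relation_Operators.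

Set Implicit Arguments.
Unset Strict Implicit.
Unset Printing Implicit Defensive.

(* Edges form a family indexed by [edge], so that distinct indices may carry
   the same vertex set (parallel edges). *)
Record hypergraph := Hypergraph {
  vert : finType;
  edge : finType;
  ends : edge -> {set vert};
  ends_neq0 : forall e, ends e != set0
}.

Definition perfect_matching (H : hypergraph) (M : {set edge H}) : bool :=
  [forall v : vert H, #|[set e in M | v \in ends e]| == 1].

Definition adjacent (H : hypergraph) : rel (vert H) :=
  fun u v => [exists e : edge H, (u \in ends e) && (v \in ends e)].

Definition connected (H : hypergraph) : bool :=
  [forall u : vert H, forall v : vert H, connect (@adjacent H) u v].

Definition matching_covered (H : hypergraph) : bool :=
  [&& connected H,
      0 < #|edge H| &
      [forall e : edge H, exists M : {set edge H},
        perfect_matching M && (e \in M)]].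

Definition uniformable (H : hypergraph) : Prop :=
  exists (m : vert H -> int) (r : int),
    (forall v, 1 <= m v)%R /\
    (forall e : edge H, \sum_(v in ends e) m v = r)%R.

Definition cut (H : hypergraph) (S : {set vert H}) : {set edge H} :=
  [set e | (ends e :&: S != set0) && (ends e :&: ~: S != set0)].

Definition tight_cut (H : hypergraph) (S : {set vert H}) : bool :=
  [forall M : {set edge H}, perfect_matching M ==> (#|M :&: cut S| == 1)].

Definition trivial_cut (H : hypergraph) (S : {set vert H}) : bool :=
  (#|S| == 1) || (#|~: S| == 1).

Definition nontrivial_tight_cut (H : hypergraph) (S : {set vert H}) : bool :=
  tight_cut S && ~~ trivial_cut S.

Section Contraction.
Variables (H : hypergraph) (S : {set vert H}).

(* [None] is the new vertex replacing [S]. *)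
Definition contract_vert := option {v : vert H | v \notin S}.

Definition contract_edge :=
  {e : edge H | (ends e \subset ~: S) || (e \in cut S)}.

Definition contract_ends (e : contract_edge) : {set contract_vert} :=
  [set x | if x is Some v then val v \in ends (val e) else val e \in cut S].

Lemma contract_ends_neq0 e : contract_ends e != set0.
Proof.
case: (boolP (val e \in cut S)) => eC.
  by apply/set0Pn; exists None; rewrite inE.
have eS : ends (val e) \subset ~: S by have := valP e; rewrite /= (negPf eC) orbF.
have /set0Pn[v ve] := ends_neq0 (val e).
have vS : v \notin S by have := subsetP eS v ve; rewrite inE.
by apply/set0Pn; exists (Some (exist _ v vS)); rewrite inE.
Qed.

(* The contraction H_S; the other contraction, in which the complement of [S]
   is replaced by a single vertex, is [contract (~: S)]. *)
Definition contract : hypergraph := Hypergraph contract_ends_neq0.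

End Contraction.

Inductive decomposition_step : seq hypergraph -> seq hypergraph -> Prop :=
| DecompositionStep (L1 L2 : seq hypergraph) (H : hypergraph)
    (S : {set vert H}) :
    nontrivial_tight_cut S ->
    decomposition_step (L1 ++ H :: L2)
      (L1 ++ [:: contract S, contract (~: S) & L2]).

Definition has_nontrivial_tight_cut (H : hypergraph) : bool :=
  [exists S : {set vert H}, nontrivial_tight_cut S].

Definition decomposition_output (H : hypergraph) (L : seq hypergraph) : Prop :=
  clos_refl_trans_1n (seq hypergraph) decomposition_step [:: H] L /\
  ~~ has has_nontrivial_tight_cut L.

Definition isomorphic (G H : hypergraph) : Prop :=
  exists (f : vert G -> vert H) (g : edge G -> edge H),
    [/\ bijective f, bijective g & forall e, ends (g e) = f @: ends e].

Section Simplification.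
Variable H : hypergraph.

Definition parallel_representative (e : edge H) : bool :=
  [pick e' | ends e' == ends e] == Some e.

Definition simplified_ends (e : {e : edge H | parallel_representative e}) :
    {set vert H} := ends (val e).

Lemma simplified_ends_neq0 e : simplified_ends e != set0.
Proof. exact: ends_neq0. Qed.

(* Exactly one edge is kept from each class of parallel edges: [pick] depends
   only on the extension of its predicate, hence only on the class of [e]. *)
Definition simplify : hypergraph := Hypergraph simplified_ends_neq0.

End Simplification.

Definition isomorphic_up_to_parallel (G H : hypergraph) : Prop :=
  isomorphic (simplify G) (simplify H).

(* Main.v *)
(* Everything is read on the set family [fam H] of the edges of [H].  Reducing
   the weights of a uniformable hypergraph modulo the common edge weight gives
   [w] with values in an abelian group, zero on every edge and nonzero on every
   proper nonempty part of an edge.  Hence all edges crossing a tight cut [S]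
   meet [S] in the same weight [wt w S], and for two tight cuts [S], [T] the
   value of [wt w (S :&: T)] decides which pair of opposite corners is tight
   again.  As in Lovasz's proof for graphs, induction on the number of vertices
   shows that decompositions starting with [S] and with [T] agree: directly if
   the cuts are laminar, through a nontrivial tight corner if they cross, and,
   if both tight opposite corners [S :&: T] and [~: S :&: ~: T] are single
   vertices, because [contract S] and [contract (~: T)] then have the same
   edges up to parallel ones.  If [wt w (S :&: T)] is generic, all four corners
   are tight, and when all are single vertices the whole vertex set is the only
   edge. *)

Require Import Defs.
From mathcomp Require Import all_boot all_order all_algebra.
From Stdlib Require SetoidPermutation.

Set Implicit Arguments.
Unset Strict Implicit.
Unset Printing Implicit Defensive.

Import GRing.Theory.

(** * Set families and tight cuts *)

Section Family.
Variable V : finType.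
Implicit Types (F P : {set {set V}}) (S T B X : {set V}).

Definition crosses S B := (B :&: S != set0) && (B :&: ~: S != set0).

Lemma crossesP S B :
  reflect ((exists2 x, x \in B & x \in S) /\ (exists2 y, y \in B & y \notin S))
          (crosses S B).
Proof.
apply: (iffP andP) => [[/set0Pn[x /setIP[xB xS]] /set0Pn[y /setIP[yB]]]|].
  by rewrite inE => yS; split; [exists x | exists y].
case=> [[x xB xS] [y yB yS]].
by split; apply/set0Pn; [exists x | exists y]; rewrite !inE ?xB ?yB.
Qed.

Lemma crossesI S B x y :
  x \in B -> x \in S -> y \in B -> y \notin S -> crosses S B.
Proof. by move=> *; apply/crossesP; split; [exists x | exists y]. Qed.

Lemma crossesC S B : crosses (~: S) B = crosses S B.
Proof. by rewrite /crosses setCK andbC. Qed.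

Lemma ncrosses_in S B x : ~~ crosses S B -> x \in B -> x \in S -> B \subset S.
Proof.
move=> nc xB xS; apply/subsetP => y yB; apply: contraR nc => yS.
exact: crossesI xB xS yB yS.
Qed.

Definition pm F P :=
  [/\ P \subset F, forall v, exists2 B, B \in P & v \in B
    & forall B B' v, B \in P -> B' \in P -> v \in B -> v \in B' -> B = B'].

Definition tight F S :=
  forall P, pm F P -> exists C, [set B in P | crosses S B] = [set C].

Lemma tightC F S : tight F S -> tight F (~: S).
Proof.
move=> tS P /tS[C eC]; exists C; rewrite -eC.
by apply/setP => B; rewrite !inE crossesC.
Qed.

Lemma tight_crossing F S P : tight F S -> pm F P ->
  exists C, [/\ C \in P, crosses S C
              & forall B, B \in P -> crosses S B -> B = C].
Proof.
move=> tS /tS[C eC]; exists C.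
have := set11 C; rewrite -eC inE => /andP[CP CS]; split=> // B BP BS.
by apply/set1P; rewrite -eC inE BP.
Qed.

Variable Z : zmodType.
Local Open Scope ring_scope.
Implicit Types (w : V -> Z).

Definition wt w X : Z := \sum_(v in X) w v.

(** Values in a group, instead of positive integers with a common edge sum, let [wt w S] itself be
    the weight of the trace on a tight [S] of every crossing edge, with no residue to choose. *)
Definition zero_sum F w :=
  forall B X, B \in F -> X \subset B ->
    (wt w X == 0) = (X == set0) || (X == B).

(** The invariant of the induction: matching covered and uniformable, read on edge sets and stable
    under tight cut contraction with [Z] fixed. The fourth clause is connectedness. *)
Definition good F :=
  [/\ (exists P, pm F P),
      (forall B, B \in F -> exists2 P, pm F P & B \in P),
      (forall B, B \in F -> (1 < #|B|)%N),
      (forall S, S != set0 -> S != setT -> exists2 B, B \in F & crosses S B)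
    & exists w, zero_sum F w].

Lemma wtID w X S : wt w X = wt w (X :&: S) + wt w (X :&: ~: S).
Proof. by rewrite /wt (big_setID S) setDE. Qed.

Lemma wt_edge F w B : zero_sum F w -> B \in F -> wt w B = 0.
Proof. by move=> zw BF; apply/eqP; rewrite (zw B) // eqxx orbT. Qed.

Lemma wt_pm F w P X : pm F P -> wt w X = \sum_(B in P) wt w (B :&: X).
Proof.
case=> _ cP uP; rewrite /wt (exchange_big_dep (mem X)) /=; last first.
  by move=> B v _ /setIP[].
apply: eq_bigr => v vX; have [B BP vB] := cP v.
rewrite (big_pred1 B) // => B'; rewrite !inE vX andbT.
apply/andP/eqP => [[BP' vB']|->//]; exact: uP vB' vB.
Qed.

(** A matching edge that does not cross [X] meets it in the empty set or in the whole edge, and both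
    have weight zero. *)
Lemma wt_crossing F w P X : zero_sum F w -> pm F P ->
  wt w X = \sum_(B in [set B in P | crosses X B]) wt w (B :&: X).
Proof.
move=> zw pP; rewrite (wt_pm w X pP) (bigID (crosses X)) /= addrC.
rewrite big1 ?add0r; first by apply: eq_bigl => B; rewrite inE.
move=> B /andP[BP nc]; have BF : B \in F by case: pP => /subsetP/(_ _ BP).
apply/eqP; rewrite (zw B) ?subsetIl //.
have [->|[x /setIP[xB xX]]] := set_0Vmem (B :&: X); first by rewrite eqxx.
by rewrite (setIidPl (ncrosses_in nc xB xX)) eqxx orbT.
Qed.

Lemma wt_setT F w : good F -> zero_sum F w -> wt w [set: V] = 0.
Proof.
case=> [[P pP] _ _ _ _] zw; rewrite (wt_crossing _ zw pP) big1 // => B.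
by rewrite inE => /andP[_ /crossesP[_ [y]]]; rewrite inE.
Qed.

Lemma wtC F w X : good F -> zero_sum F w -> wt w (~: X) = - wt w X.
Proof.
move=> gF zw; apply/eqP; rewrite -addr_eq0 addrC; apply/eqP.
by have := wtID w [set: V] X; rewrite !setTI (wt_setT gF zw).
Qed.

Lemma wt_setCI F w S T : good F -> zero_sum F w ->
  wt w (~: S :&: ~: T) = wt w (S :&: T) - wt w S - wt w T.
Proof.
move=> gF zw; have := wtID w (~: T) S.
rewrite (wtC _ gF zw) (setIC _ S) (setIC _ (~: S)) => eT.
by rewrite eT (wtID w S T) opprD !addrA subrr add0r addNr add0r.
Qed.

(** In a perfect matching through [B], the edge [B] is the only one crossing [S], so it carries the
    whole weight of [S]. *)
Lemma tight_wt F w S B : good F -> zero_sum F w -> tight F S ->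
  B \in F -> crosses S B -> wt w (B :&: S) = wt w S.
Proof.
case=> [_ eP _ _ _] zw tS BF cB; have [P pP BP] := eP B BF.
rewrite (wt_crossing S zw pP); have [C eC] := tS P pP; rewrite eC big_set1.
have : B \in [set B in P | crosses S B] by rewrite inE BP.
by rewrite eC => /set1P->.
Qed.

(* Two distinct matching edges both crossing [S :&: T] would have to lie one
   in [T] and the other in [S], giving weight [wt w S + wt w T]. *)
Lemma tight_setI F w S T : good F -> zero_sum F w -> tight F S -> tight F T ->
  wt w (S :&: T) != 0 -> wt w (S :&: T) != wt w S + wt w T ->
  tight F (S :&: T).
Proof.
move=> gF zw tS tT n0 nD P pP.
have [C [CP CS uC]] := tight_crossing tS pP.
have [D [DP DT uD]] := tight_crossing tT pP.
have PF B : B \in P -> B \in F by case: pP => /subsetP sPF _ _; exact: sPF.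
set K := [set _ in P | _].
have wK := wt_crossing (S :&: T) zw pP; rewrite -/K in wK.
have KCD B : B \in K -> B = C \/ B = D.
  rewrite inE => /andP[BP /crossesP[[x xB /setIP[xS xT]] [y yB]]].
  rewrite inE negb_and => /orP[yS|yT].
    by left; apply: uC => //; exact: crossesI xB xS yB yS.
  by right; apply: uD => //; exact: crossesI xB xT yB yT.
have single E : E \in K -> (forall B, B \in K -> B = E) -> exists E', K = [set E'].
  by move=> EK uE; exists E; apply/setP => B; rewrite inE; apply/idP/eqP => [/uE|->].
have [CK|CK] := boolP (C \in K); last first.
  have [DK|DK] := boolP (D \in K).
    apply: (single D DK) => B BK; case: (KCD B BK) => // eB.
    by rewrite -eB BK in CK.
  case/eqP: n0; rewrite wK big1 // => B BK.
  by case: (KCD B BK) => eB; rewrite -eB BK // in CK DK.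
have [DK|DK] := boolP (D \in K); last first.
  apply: (single C CK) => B BK; case: (KCD B BK) => // eB.
  by rewrite -eB BK in DK.
have [eCD|nCD] := eqVneq C D.
  by apply: (single C CK) => B BK; case: (KCD B BK) => // ->.
have CT : C \subset T.
  move: CK; rewrite inE => /andP[_ /crossesP[[x xC /setIP[_ xT]] _]].
  by apply: ncrosses_in xC xT; apply: contra nCD => cT; rewrite (uD C).
have DS : D \subset S.
  move: DK; rewrite inE => /andP[_ /crossesP[[x xD /setIP[xS _]] _]].
  by apply: ncrosses_in xD xS; apply: contra nCD => cS; rewrite (uC D).
case/eqP: nD; rewrite wK.
have -> : K = [set C; D].
  apply/setP => B; rewrite in_set2; apply/idP/orP => [/KCD[]->|[]/eqP->//];
  by [left|right].
rewrite big_setU1 ?inE //= big_set1.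
rewrite -(tight_wt gF zw tS (PF _ CP) CS) -(tight_wt gF zw tT (PF _ DP) DT).
congr (wt w _ + wt w _); last by rewrite setIA (setIidPl DS).
by rewrite (setIC S) setIA (setIidPl CT).
Qed.

(** The weight is that of the trace of a crossing edge, a proper nonempty part of this edge. *)
Lemma tight_wt_neq0 F w S :
  good F -> zero_sum F w -> tight F S -> wt w S != 0.
Proof.
move=> gF zw tS; have [[P pP] _ _ _ _] := gF.
have [C [CP CS _]] := tight_crossing tS pP.
have CF : C \in F by case: pP => /subsetP/(_ _ CP).
rewrite -(tight_wt gF zw tS CF CS) (zw C) ?subsetIl // negb_or.
have/andP[-> _] /= := CS; apply: contraTN CS => /eqP/setIidPl CS.
by apply/negP => /crossesP[_ [y /(subsetP CS)->]].
Qed.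

(** The two values forbidden in [tight_setI] are excluded because tight sets have nonzero weight. By
    [wt_setCI] the two values forbidden for the opposite corner amount to the same two conditions,
    in exchanged order. *)
Lemma uncrossing F w S T : good F -> zero_sum F w -> tight F S -> tight F T ->
  wt w (S :&: T) = wt w S \/ wt w (S :&: T) = wt w T ->
  tight F (S :&: T) /\ tight F (~: S :&: ~: T).
Proof.
move=> gF zw tS tT ab.
have nz X : tight F X -> wt w X != 0 by exact: tight_wt_neq0.
have n0 : wt w (S :&: T) != 0 by case: ab => ->; exact: nz.
have nD : wt w (S :&: T) != wt w S + wt w T.
  case: ab => ->; first by rewrite eq_sym -subr_eq0 addrC addKr nz.
  by rewrite eq_sym -subr_eq0 addrK nz.
split; first exact: tight_setI nD.
have e := wt_setCI S T gF zw.
apply: (tight_setI gF zw); rewrite ?e ?(wtC _ gF zw); do ?exact: tightC.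
  by rewrite -addrA -opprD subr_eq0.
by rewrite -addrA -subr_eq0 addrK.
Qed.

End Family.

(** * Tight cuts meeting in a single vertex *)

Section Corners.
Variables (V : finType) (Z : zmodType) (F : {set {set V}}) (w : V -> Z).
Hypotheses (gF : good Z F) (zw : zero_sum F w).

(** Since [u] alone has the weight of [B :&: S], the rest of this trace is a part of [B] of weight
    zero. It misses [u], so it is not [B] and must be empty. *)
Lemma corner_edge S T u B :
  tight F S -> S :&: T = [set u] -> w u = wt w S ->
  B \in F -> crosses S B -> u \in B -> B :&: S = [set u].
Proof.
move=> tS eu wu BF cB uB; have uS : u \in S.
  by have := set11 u; rewrite -eu => /setIP[].
have := wtID w (B :&: S) [set u].
have -> : B :&: S :&: [set u] = [set u] by apply/setIidPr; rewrite sub1set inE uB.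
rewrite (tight_wt gF zw tS BF cB) {2}/wt big_set1 -wu => /esym/eqP.
rewrite -subr_eq0 addrC addKr (zw BF); last by rewrite -setIA subsetIl.
case/orP => /eqP e.
  apply/eqP; rewrite eqEsubset sub1set inE uB uS andbT.
  by rewrite -setD_eq0 setDE e eqxx.
by have := uB; rewrite -{1}e !inE eqxx andbF.
Qed.

(** The matching edge through [u] is not [C], so it stays inside [S] and meets [T] only in [u].
    Having a second vertex, it leaves [T], and hence is [D]. *)
Lemma corner_other S T u P C D :
  S :&: T = [set u] -> pm F P -> C \in P ->
  (forall B, B \in P -> crosses S B -> B = C) ->
  (forall B, B \in P -> crosses T B -> B = D) -> u \notin C ->
  [/\ u \in D, D \subset S & D :&: T = [set u]].
Proof.
move=> eu [sPF cP _] CP uC uD nuC.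
have /setIP[uS uT] : u \in S :&: T by rewrite eu set11.
have [B BP uB] := cP u; have [_ _ nsing _ _] := gF.
have nS : ~~ crosses S B by apply: contra nuC => /(uC _ BP)<-.
have BS := ncrosses_in nS uB uS.
have eB : B :&: T = [set u].
  apply/eqP; rewrite eqEsubset sub1set inE uB uT andbT -eu.
  by rewrite setSI.
suff cT : crosses T B by rewrite -(uD _ BP cT).
have := nsing _ (subsetP sPF _ BP); rewrite (cardsD1 u) uB add1n ltnS card_gt0.
case/set0Pn=> y /setD1P[yu yB]; apply: (crossesI uB uT yB).
by apply: contra yu => yT; rewrite -in_set1 -eB inE yB.
Qed.

(** Take a matching through an edge [B] crossing [S :\: T]. If its edge [C] crossing [S] contained
    [u], then [C] would meet [S] only there, so [B] would differ from [C], lie inside [S] and also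
    contain [u]. Hence [C] misses [u], and [corner_other] gives an edge whose trace on [T] is [u]
    alone. *)
Lemma corner_weights S T u :
  tight F S -> tight F T -> S :&: T = [set u] -> S != [set u] ->
  w u = wt w S -> wt w S = wt w T.
Proof.
move=> tS tT eu nS wu; have [_ eP _ con _] := gF.
have /setIP[uS uT] : u \in S :&: T by rewrite eu set11.
have X0 : S :\: T != set0.
  apply: contra nS; rewrite setD_eq0 => /setIidPl <-; exact/eqP.
have XT : S :\: T != setT.
  by apply/negP => /eqP/setP/(_ u); rewrite !inE uT.
have [B BF cB] := con _ X0 XT; have [P pP BP] := eP B BF.
have sPF E : E \in P -> E \in F by case: pP => /subsetP sPF _ _ /sPF.
have [C [CP CS uC]] := tight_crossing tS pP.
have [D [DP DT uD]] := tight_crossing tT pP.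
have [uC'|nuC] := boolP (u \in C); last first.
  have [uD' _ eD] := corner_other eu pP CP uC uD nuC.
  by rewrite -(tight_wt gF zw tT (sPF _ DP) DT) eD /wt big_set1.
have eC := corner_edge tS eu wu (sPF _ CP) CS uC'.
have [[z zB /setDP[zS zT]] [y yB]] := crossesP _ _ cB.
have BC : B != C.
  apply: contraNneq zT => eBC; have : z \in C :&: S by rewrite inE -eBC zB.
  by rewrite eC => /set1P->.
have BS : B \subset S.
  by apply: ncrosses_in zB zS; apply: contra BC => /(uC _ BP)/eqP.
rewrite inE (subsetP BS _ yB) andbT negbK => yT.
have : y \in S :&: T by rewrite inE yT (subsetP BS).
rewrite eu => /set1P eyu; case/eqP: BC; case: pP => _ _ /(_ B C u); apply=> //.
by rewrite -eyu.
Qed.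

End Corners.

(** * Images of set families *)

(** The size condition discards edges shrunk to one vertex, as a contraction discards the edges
    inside the contracted set. Edges that become parallel are merged. *)
Definition fimage (V W : finType) (q : V -> W) (F : {set {set V}}) :=
  [set q @: B | B : {set V} in F & 1 < #|q @: B|].

Lemma fimageP (V W : finType) (q : V -> W) (F : {set {set V}}) D :
  reflect (exists2 B, B \in F & D = q @: B /\ 1 < #|D|) (D \in fimage q F).
Proof.
apply: (iffP imsetP) => [[B /setIdP[BF cB] ->]|[B BF [-> cB]]]; exists B => //.
by rewrite inE BF.
Qed.

Lemma fimage_comp (U V W : finType) (p : V -> W) (q : U -> V) (F : {set {set U}}) :
  fimage p (fimage q F) = fimage (p \o q) F.
Proof.
apply/setP => D; apply/fimageP/fimageP.
  move=> [_ /fimageP[B BF [-> _]] [-> cD]]; exists B => //; split=> //.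
  by rewrite imset_comp.
move=> [B BF [-> cD]]; rewrite imset_comp in cD *.
exists (q @: B) => //; apply/fimageP; exists B => //; split=> //.
exact: leq_trans cD (leq_imset_card _ _).
Qed.

Lemma fimage_inj (V W : finType) (h : V -> W) (F : {set {set V}}) : injective h ->
  (forall B, B \in F -> 1 < #|B|) -> fimage h F = [set h @: B | B : {set V} in F].
Proof.
move=> ih nF; apply/setP => D; apply/fimageP/imsetP; case=> B BF.
  by case=> -> _; exists B.
by move=> ->; exists B; rewrite // card_imset // nF.
Qed.

Lemma eq_fimage (V W : finType) (q r : V -> W) F :
  q =1 r -> fimage q F = fimage r F.
Proof.
move=> e; apply/setP => D; apply/fimageP/fimageP => -[B BF]; exists B => //.
  by rewrite -(eq_imset _ e).
by rewrite (eq_imset _ e).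
Qed.

Lemma fimage_card (V W : finType) (q : V -> W) (F : {set {set V}}) D :
  D \in fimage q F -> 1 < #|D|.
Proof. by case/fimageP => B _ []. Qed.

(** Contraction of [S] modelled inside [V], with a vertex [u] of [S] as the new vertex. Contractions
    of different sets thereby become families on one vertex set and can be compared by equality. *)
Definition collapse (V : finType) (S : {set V}) (u : V) : V -> V :=
  fun x => if x \in S then u else x.

Section CollapsedCorners.
Variables (V : finType) (Z : zmodType) (F : {set {set V}}).
Hypothesis gF : good Z F.

(** Both maps agree on an edge that meets [S] at most in [u]. An edge [B] crossing [S] and missing
    [u] is exchanged for the edge [D] crossing [T] in a matching through [B]: [B] leaves [S] only at
    [v] and [D] meets [T] only at [u], so both images are [[set u; v]]. *)
Lemma collapse_corner_sub (w : V -> Z) S T u v :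
  zero_sum F w -> tight F S -> tight F T ->
  S :&: T = [set u] -> ~: S :&: ~: T = [set v] ->
  w u = wt w S -> w u = wt w T -> w v = wt w (~: S) ->
  fimage (collapse S u) F \subset fimage (collapse (~: T) v) F.
Proof.
move=> zw tS tT eu ev wS wT wv; have [_ eP _ _ _] := gF.
have /setIP[uS uT] : u \in S :&: T by rewrite eu set11.
have /setIP[] : v \in ~: S :&: ~: T by rewrite ev set11.
rewrite !in_setC => vS vT.
have out x : x \notin S -> collapse (~: T) v x = x.
  rewrite /collapse inE; case: ifP => // xT xS; apply/esym/eqP.
  by rewrite -in_set1 -ev !inE xS.
apply/subsetP => _ /fimageP[B BF [-> cB]].
have same : (forall x, x \in B -> x \in S -> x = u) ->
    collapse S u @: B \in fimage (collapse (~: T) v) F.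
  move=> BS; have e : collapse S u @: B = collapse (~: T) v @: B.
    apply: eq_in_imset => x xB; have [xS|xS] := boolP (x \in S).
      by rewrite (BS x xB xS) /collapse uS inE uT.
    by rewrite out // /collapse (negPf xS).
  by apply/fimageP; exists B.
have [cS|nS] := boolP (crosses S B); last first.
  apply: same => x xB xS; move: cB.
  rewrite (_ : collapse S u @: B = [set u]) ?cards1 //.
  apply/setP => y; rewrite inE; apply/imsetP/eqP => [[z zB ->]|->].
    by rewrite /collapse (subsetP (ncrosses_in nS xB xS)).
  by exists x => //; rewrite /collapse xS.
have [uB|nuB] := boolP (u \in B).
  apply: same => x xB xS; apply/set1P.
  by rewrite -(corner_edge gF zw tS eu wS BF cS uB) inE xB.
have [P pP BP] := eP B BF.
have [C [CP CS uC]] := tight_crossing tS pP.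
have [D [DP DT uD]] := tight_crossing tT pP.
have eBC := uC _ BP cS; subst C.
have [uDd DS eD] := corner_other gF eu pP BP uC uD nuB.
(* Otherwise [corner_other] at the opposite corner puts [v] into [D], which lies inside [S]. *)
have vB : v \in B.
  apply: contraNT vS => nvB.
  have uC' E : E \in P -> crosses (~: S) E -> E = B by rewrite crossesC; exact: uC.
  have uD' E : E \in P -> crosses (~: T) E -> E = D by rewrite crossesC; exact: uD.
  have [vD _ _] := corner_other gF ev pP BP uC' uD' nvB.
  exact: (subsetP DS).
have eB : B :&: ~: S = [set v].
  by apply: (corner_edge gF zw (tightC tS) ev wv BF); rewrite ?crossesC.
have -> : collapse S u @: B = collapse (~: T) v @: D.
  have [[a aB aS] _] := crossesP _ _ cS.
  have [_ [b bD bT]] := crossesP _ _ DT.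
  transitivity [set u; v].
    apply/setP => y; rewrite in_set2; apply/imsetP/orP.
      case=> x xB ->; rewrite /collapse; case: ifPn => [_|xS]; first by left.
      by right; rewrite -in_set1 -eB !inE xB.
    case=> /eqP->; first by exists a; rewrite // /collapse aS.
    by exists v; rewrite // /collapse (negPf vS).
  apply/esym/setP => y; rewrite in_set2; apply/imsetP/orP.
    case=> x xD ->; rewrite /collapse inE; case: ifPn => [_|]; first by right.
    by rewrite negbK => xT; left; rewrite -in_set1 -eD inE xD.
  case=> /eqP->; first by exists u; rewrite // /collapse inE uT.
  by exists b; rewrite // /collapse inE bT.
apply/fimageP; exists D; first by case: pP => /subsetP/(_ _ DP).
split=> //; rewrite (cardsD1 u) (cardsD1 v) !inE.
have -> : u \in collapse (~: T) v @: D.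
  by apply/imsetP; exists u => //; rewrite /collapse inE uT.
have -> : v \in collapse (~: T) v @: D.
  have [_ [b bD bT]] := crossesP _ _ DT.
  by apply/imsetP; exists b => //; rewrite /collapse inE bT.
by have -> : v != u by apply: contraNneq vS => ->.
Qed.

(** [corner_weights] turns either equality into both. The reverse inclusion is [collapse_corner_sub]
    for [~: T] and [~: S], with [u] and [v] exchanged. *)
Lemma collapse_corner (w : V -> Z) S T u v :
  zero_sum F w -> tight F S -> tight F T ->
  S :&: T = [set u] -> ~: S :&: ~: T = [set v] ->
  S != [set u] -> T != [set u] ->
  w u = wt w S \/ w u = wt w T ->
  fimage (collapse S u) F = fimage (collapse (~: T) v) F.
Proof.
move=> zw tS tT eu ev nS nT wST.
have [wS wT] : w u = wt w S /\ w u = wt w T.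
  case: wST => e; split=> //; rewrite e.
    exact: corner_weights gF zw _ _ _ tS tT eu nS e.
  by apply: corner_weights gF zw _ _ _ tT tS _ nT e; rewrite setIC.
(* As [u] already carries the weight of [S], the corner [S :&: ~: T] has weight zero, which leaves
   the whole weight of [~: T] to [v]. *)
have wv : w v = wt w (~: S) /\ w v = wt w (~: T).
  have := wtID w (~: T) S; rewrite !(wtC _ gF zw) (setIC _ S) (setIC _ (~: S)).
  have := wtID w S T; rewrite eu ev /wt !big_set1 -/(wt w S) -/(wt w T) -wS -wT.
  rewrite -{1}[w u]addr0 => /addrI <-.
  by rewrite add0r => ->.
have [wvS wvT] := wv.
apply/eqP; rewrite eqEsubset (collapse_corner_sub zw tS tT eu ev) //=.
rewrite -[S]setCK (collapse_corner_sub zw (tightC tT) (tightC tS)) //.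
- by rewrite setIC.
- by rewrite setIC !setCK.
- by rewrite setCK.
Qed.

(** An edge not crossing [S] has at least two vertices on a side of size two, so it equals that
    side. But edges have weight zero and tight sides do not. So every edge crosses [S], and a
    perfect matching consists of one edge. *)
Lemma tight_halves S B :
  tight F S -> #|S| = 2 -> #|~: S| = 2 -> B \in F -> B = setT.
Proof.
move=> tS c1 c2 BF; have [_ eP nsing _ [w zw]] := gF.
have cr E : E \in F -> crosses S E.
  move=> EF; apply: contraT => nc; have [|x xE] := @set0Pn _ E _.
    by rewrite -card_gt0 ltnW // nsing.
  have wE := wt_edge zw EF.
  have [xS|xS] := boolP (x \in S).
    have eE : E = S by apply/eqP; rewrite eqEcard (ncrosses_in nc xE xS) c1 nsing.
    by have := tight_wt_neq0 gF zw tS; rewrite -eE wE eqxx.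
  have nc' : ~~ crosses (~: S) E by rewrite crossesC.
  have xS' : x \in ~: S by rewrite inE.
  have eE : E = ~: S.
    by apply/eqP; rewrite eqEcard (ncrosses_in nc' xE xS') c2 nsing.
  by have := tight_wt_neq0 gF zw (tightC tS); rewrite -eE wE eqxx.
have [P pP BP] := eP B BF.
have [C [CP CS uC]] := tight_crossing tS pP.
have [/subsetP sPF cP _] := pP.
apply/setP => x; rewrite inE; have [E EP xE] := cP x.
by rewrite (uC B) ?cr // -(uC E) ?cr ?sPF.
Qed.

End CollapsedCorners.

(** * Similarity of set families *)

Definition surj (V W : finType) (q : V -> W) := forall x, exists v, q v = x.

Section Similarity.
Implicit Types (U V W X : finType).

(* Isomorphism up to parallel edges, read on the sets of edges. *)
Definition fsim V W (F : {set {set V}}) (G : {set {set W}}) :=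
  exists2 f : V -> W, bijective f & forall D : {set V}, (f @: D \in G) = (D \in F).

Lemma fsim_refl V (F : {set {set V}}) : fsim F F.
Proof. by exists id => [|D]; [exists id | rewrite imset_id]. Qed.

Lemma fsim_sym V W (F : {set {set V}}) (G : {set {set W}}) :
  fsim F G -> fsim G F.
Proof.
case=> f [g fK gK] fG; exists g => [|D]; first by exists f.
by rewrite -fG -imset_comp (eq_imset _ gK) imset_id.
Qed.

Lemma fsim_trans U V W (E : {set {set U}}) (F : {set {set V}})
    (G : {set {set W}}) : fsim E F -> fsim F G -> fsim E G.
Proof.
case=> f bf fE [g bg gF]; exists (g \o f) => [|D]; first exact: bij_comp.
by rewrite imset_comp gF fE.
Qed.

Lemma surj_factor V W X (q : V -> W) (r : V -> X) :
  surj q -> (forall x y, q x = q y <-> r x = r y) ->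
  exists2 h : W -> X, injective h & forall v, h (q v) = r v.
Proof.
move=> sq ker.
have ex x : exists v, q v == x by have [v <-] := sq x; exists v.
pose s x := xchoose (ex x).
have sK x : q (s x) = x by exact/eqP/(xchooseP (ex x)).
exists (fun x => r (s x)) => [x y /ker|v]; first by rewrite !sK.
by apply/ker; rewrite sK.
Qed.

(** Through [r1] and [r2] both quotients embed into [X] with the same range. The bijection goes into
    [X] by one embedding and back by the other. It serves to compare contractions through their
    collapses. *)
Lemma fsim_fimage V W1 W2 X (F : {set {set V}}) (q1 : V -> W1) (q2 : V -> W2)
    (r1 r2 : V -> X) :
  surj q1 -> surj q2 ->
  (forall x y, q1 x = q1 y <-> r1 x = r1 y) ->
  (forall x y, q2 x = q2 y <-> r2 x = r2 y) ->
  (forall v, exists v', r2 v' = r1 v) -> (forall v, exists v', r1 v' = r2 v) ->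
  fimage r1 F = fimage r2 F ->
  fsim (fimage q1 F) (fimage q2 F).
Proof.
move=> s1 s2 k1 k2 r12 r21 eF.
have [h1 i1 e1] := surj_factor s1 k1; have [h2 i2 e2] := surj_factor s2 k2.
have exf x : exists y, h2 y == h1 x.
  have [v <-] := s1 x; rewrite e1; have [v' <-] := r12 v.
  by exists (q2 v'); rewrite e2.
have exg y : exists x, h1 x == h2 y.
  have [v <-] := s2 y; rewrite e2; have [v' <-] := r21 v.
  by exists (q1 v'); rewrite e1.
pose f x := xchoose (exf x); pose g y := xchoose (exg y).
have fE x : h2 (f x) = h1 x by exact/eqP/(xchooseP (exf x)).
have gE y : h1 (g y) = h2 y by exact/eqP/(xchooseP (exg y)).
exists f; first by exists g => x; [apply: i1; rewrite gE fE | apply: i2; rewrite fE gE].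
have via W (q : V -> W) r (h : W -> X) (D : {set W}) : injective h ->
    (forall v, h (q v) = r v) -> (D \in fimage q F) = (h @: D \in fimage r F).
  move=> ih eh; have -> : fimage r F = fimage (h \o q) F.
    by apply: eq_fimage => v; rewrite /= eh.
  rewrite -fimage_comp (fimage_inj ih); last by move=> B; exact: fimage_card.
  by rewrite mem_imset //; exact: imset_inj.
move=> D; rewrite (via _ _ _ _ _ i1 e1) (via _ _ _ _ _ i2 e2) eF.
by rewrite -imset_comp (eq_imset _ fE).
Qed.

Lemma fsim_kernel V W1 W2 (F : {set {set V}}) (q1 : V -> W1) (q2 : V -> W2) :
  surj q1 -> surj q2 -> (forall x y, q1 x = q1 y <-> q2 x = q2 y) ->
  fsim (fimage q1 F) (fimage q2 F).
Proof.
move=> s1 s2 k; apply: (@fsim_fimage _ _ _ _ F q1 q2 q1 q1) => //;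
  try by move=> v; exists v.
by move=> x y; split=> /k.
Qed.

End Similarity.

(** * Contraction of a tight cut *)

(** The quotient map onto the vertices of [contract S]: [insub] fails exactly on [S], giving the new
    vertex [None]. *)
Definition proj (V : finType) (S : {set V}) (v : V) : option {v | v \notin S} :=
  insub v.

Section Projection.
Variables (V : finType) (S : {set V}).

Lemma proj_in v : v \in S -> proj S v = None.
Proof. by move=> vS; rewrite /proj insubF // vS. Qed.

Lemma proj_out v (vS : v \notin S) : proj S v = Some (exist _ v vS).
Proof. by rewrite /proj insubT. Qed.

Lemma proj_val (x : {v | v \notin S}) : proj S (val x) = Some x.
Proof. by rewrite /proj valK. Qed.

Lemma proj_eq x y :
  proj S x = proj S y <-> x = y \/ (x \in S /\ y \in S).
Proof.
split=> [|[->|[xS yS]]] //; last by rewrite !proj_in.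
have [xS|xS] := boolP (x \in S); have [yS|yS] := boolP (y \in S).
- by right.
- by rewrite proj_in // proj_out.
- by rewrite (proj_in yS) proj_out.
- by rewrite !proj_out => -[->]; left.
Qed.

Lemma proj_surj : S != set0 -> surj (proj S).
Proof.
case/set0Pn=> u uS [x|]; first by exists (val x); exact: proj_val.
by exists u; exact: proj_in.
Qed.

Lemma mem_proj (B : {set V}) x : (Some x \in proj S @: B) = (val x \in B).
Proof.
apply/imsetP/idP => [[v vB]|xB]; last by exists (val x); rewrite ?proj_val.
rewrite -proj_val => /proj_eq[->//|[]]; by rewrite (negPf (valP x)).
Qed.

Lemma mem_proj_None (B : {set V}) :
  (None \in proj S @: B) = (B :&: S != set0).
Proof.
apply/imsetP/set0Pn => [[v vB]|[v /setIP[vB vS]]]; last first.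
  by exists v; rewrite ?proj_in.
move=> /esym; have [vS _|vS] := boolP (v \in S); last by rewrite proj_out.
by exists v; rewrite inE vB.
Qed.

Lemma card_proj (B : {set V}) :
  1 < #|B| -> (1 < #|proj S @: B|) = ~~ (B \subset S).
Proof.
move=> cB; have [/subsetP BS|/subsetPn[x xB xS]] := boolP (B \subset S).
  apply/negbTE; rewrite -leqNgt -(cards1 (None : option {v | v \notin S})).
  by apply/subset_leq_card/subsetP => _ /imsetP[v /BS vS ->]; rewrite proj_in // inE.
have xQ := imset_f (proj S) xB; rewrite (cardsD1 (proj S x)) xQ add1n ltnS card_gt0.
move: cB; rewrite (cardsD1 x) xB add1n ltnS card_gt0 => /set0Pn[y /setD1P[yx yB]].
apply/set0Pn; exists (proj S y); rewrite inE imset_f // andbT inE.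
apply: contra yx => /eqP/proj_eq[->//|[_]]; by rewrite (negPf xS).
Qed.

Lemma fimage_projP (F : {set {set V}}) D :
  (forall B, B \in F -> 1 < #|B|) ->
  reflect (exists2 B, B \in F & D = proj S @: B /\ ~~ (B \subset S))
          (D \in fimage (proj S) F).
Proof.
move=> nF; apply: (iffP (fimageP _ _ _)) => -[B BF [eD cD]]; exists B => //; split=> //.
  by rewrite -card_proj ?nF // -eD.
by rewrite eD card_proj ?nF.
Qed.

End Projection.

Lemma crosses_imset (V W : finType) (q : V -> W) T (B : {set V}) :
  crosses T (q @: B) = crosses (q @^-1: T) B.
Proof.
apply/crossesP/crossesP.
  move=> [[_ /imsetP[x xB ->] xT] [_ /imsetP[y yB ->] yT]].
  by split; [exists x | exists y]; rewrite ?inE.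
move=> [[x xB xT] [y yB yT]]; rewrite !inE in xT yT.
by split; [exists (q x) | exists (q y)]; rewrite ?imset_f.
Qed.

Section TightContraction.
Variables (V : finType) (Z : zmodType) (F : {set {set V}}) (S : {set V}).
Hypotheses (gF : good Z F) (tS : tight F S).
Let q := proj S.

Let nsing B : B \in F -> 1 < #|B|. Proof. by case: gF => _ _ h _ _; exact: h. Qed.

Lemma tight_set_neq0 : S != set0.
Proof.
have [[P pP] _ _ _ _] := gF; have [C [_ /crossesP[[x _ xS] _] _]] := tight_crossing tS pP.
by apply/set0Pn; exists x.
Qed.

Lemma pm_sub P B : pm F P -> B \in P -> B \in F.
Proof. by case=> /subsetP sPF _ _; exact: sPF. Qed.

Lemma pm_proj_inj P B C : pm F P -> B \in P -> C \in P -> ~~ (B \subset S) ->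
  q @: B = q @: C -> B = C.
Proof.
case=> _ _ uP BP CP /subsetPn[x xB xS] e; apply: (uP _ _ _ BP CP xB).
have : q x \in q @: C by rewrite -e imset_f.
by rewrite /q (proj_out xS) mem_proj.
Qed.

(** By tightness the new vertex is covered by the image of exactly one matching edge, the one
    crossing [S]. *)
Lemma pm_contract P : pm F P -> pm (fimage q F) (fimage q P).
Proof.
move=> pP; have [/subsetP sPF cP uP] := pP.
have nP B : B \in P -> 1 < #|B| by move/sPF; exact: nsing.
have [C [CP CS uC]] := tight_crossing tS pP.
have cross (B : {set V}) x : ~~ (B \subset S) -> x \in B -> x \in S -> crosses S B.
  by move=> /subsetPn[y yB yS] xB xS; exact: crossesI xB xS yB yS.
split.
- apply/subsetP => D /(fimage_projP _ nP)[B BP [-> nB]].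
  by apply/(fimage_projP _ nsing); exists B; rewrite ?sPF.
- case=> [[x xS]|].
    have [B BP xB] := cP x; exists (q @: B); last by rewrite mem_proj.
    apply/(fimage_projP _ nP); exists B => //; split=> //.
    by apply/subsetPn; exists x.
  have /andP[CS1 _] := CS; have [_ [y yC yS]] := crossesP _ _ CS.
  exists (q @: C); last by rewrite mem_proj_None.
  by apply/(fimage_projP _ nP); exists C => //; split=> //; apply/subsetPn; exists y.
move=> _ _ v /(fimage_projP _ nP)[B BP [-> nB]] /(fimage_projP _ nP)[B' BP' [-> nB']].
case: v => [x|]; rewrite ?mem_proj ?mem_proj_None => xB xB'.
  by rewrite (uP _ _ _ BP BP' xB xB').
have [y /setIP[yB yS]] := set0Pn _ xB; have [y' /setIP[yB' yS']] := set0Pn _ xB'.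
have -> : B = C by apply: uC => //; exact: cross yB yS.
by have -> : B' = C by apply: uC => //; exact: cross yB' yS'.
Qed.

(* The edge at the new vertex lifts to some [C] crossing [S]; the inside of [S]
   is filled in with any perfect matching through [C]. *)
Lemma pm_lift P' : pm (fimage q F) P' ->
  exists2 P, pm F P & P' = fimage q P.
Proof.
case=> /subsetP sP' cP' uP'.
have [_ eP _ _ _] := gF.
have [D DP' ND] := cP' None.
have /(fimage_projP _ nsing)[C CF [eD nC]] := sP' _ DP'.
have CS : crosses S C.
  have := ND; rewrite eD mem_proj_None /crosses => -> /=.
  by rewrite -setDE setD_eq0.
have [P0 pP0 CP0] := eP C CF; have [/subsetP sP0 cP0 uP0] := pP0.
have uC B : B \in P0 -> crosses S B -> B = C.
  have [C' [_ _ uC']] := tight_crossing tS pP0.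
  by move=> BP cB; rewrite (uC' C) // (uC' B).
pose P := [set B in P0 | (B \subset S) || (B == C)]
  :|: [set B in F | (B \subset ~: S) && (q @: B \in P')].
have inP B : B \in P -> (B \in P0 /\ (B \subset S \/ B = C)) \/
   [/\ B \in F, B \subset ~: S & q @: B \in P'].
  rewrite !inE => /orP[/andP[BP /orP[BS|/eqP->]]|/and3P[]]; last by right.
    by left; split=> //; left.
  by left; split=> //; right.
have PF B : B \in P -> B \in F by case/inP => [[/sP0]|[]].
have CP : C \in P by rewrite !inE CP0 eqxx orbT.
(* The image of such a [B] would share a vertex with [D], hence equal [D], which contains the new
   vertex while the image of [B] does not. *)
have outC (B : {set V}) x : B \subset ~: S -> q @: B \in P' -> x \in B -> x \notin C.
  move=> BS BP' xB; apply/negP => xC.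
  have xS : x \notin S by have := subsetP BS x xB; rewrite inE.
  have e : q @: B = D.
    by apply: (uP' _ _ (q x)) => //; rewrite ?eD imset_f.
  have := ND; rewrite -e mem_proj_None => /set0Pn[y /setIP[/(subsetP BS)]].
  by rewrite inE => /negP.
exists P; first split.
- by apply/subsetP.
- move=> v; have [vS|vS] := boolP (v \in S).
    have [B BP vB] := cP0 v; exists B => //; rewrite !inE BP /=.
    have [cB|nB] := boolP (crosses S B); first by rewrite (uC B) // eqxx orbT.
    by rewrite (ncrosses_in nB vB vS).
  have [E EP'] := cP' (q v); have /(fimage_projP _ nsing)[B BF [eE nB]] := sP' _ EP'.
  rewrite eE /q (proj_out vS) mem_proj /= => vB.
  have [nE|nE] := boolP (None \in E).
    exists C => //; have : q v \in D by rewrite (uP' _ _ _ DP' EP' ND nE) eE imset_f.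
    by rewrite eD /q (proj_out vS) mem_proj.
  exists B => //; rewrite !inE BF -eE EP' andbT (_ : B \subset ~: S) ?orbT //.
  move: nE; rewrite eE mem_proj_None negbK => /eqP BS0.
  by rewrite -disjoints_subset -setI_eq0 BS0.
- move=> B B' v /inP iB /inP iB' vB vB'.
  case: iB => [[BP iB]|[BF BS BP']]; case: iB' => [[BP0' iB']|[BF' BS' BP0']].
  + exact: uP0 vB vB'.
  + case: iB => [/subsetP/(_ _ vB) vS|eB].
      by have := subsetP BS' _ vB'; rewrite inE vS.
    by have := outC _ _ BS' BP0' vB'; rewrite -eB vB.
  + case: iB' => [/subsetP/(_ _ vB') vS|eB].
      by have := subsetP BS _ vB; rewrite inE vS.
    by have := outC _ _ BS BP' vB; rewrite -eB vB'.
  + have e : q @: B = q @: B' by apply: (uP' _ _ (q v)) => //; rewrite imset_f.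
    apply/setP => x; have [xS|xS] := boolP (x \in S).
      have nin (E : {set V}) : E \subset ~: S -> x \in E = false.
        by move=> ES; apply/negP => /(subsetP ES); rewrite inE xS.
      by rewrite !nin.
    by rewrite -[x]/(val (exist (fun v => v \notin S) x xS)) -!mem_proj -/q e.
have nP B : B \in P -> 1 < #|B| by move/PF; exact: nsing.
apply/setP => E; apply/idP/(fimage_projP _ nP) => [EP'|[B BP [-> nB]]].
  have [nE|nE] := boolP (None \in E).
    by exists C => //; split=> //; rewrite -eD; exact: uP' nE ND.
  have /(fimage_projP _ nsing)[B BF [eE nB]] := sP' _ EP'.
  exists B => //; rewrite !inE BF -eE EP' andbT (_ : B \subset ~: S) ?orbT //.
  move: nE; rewrite eE mem_proj_None negbK => /eqP BS0.
  by rewrite -disjoints_subset -setI_eq0 BS0.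
case/inP: BP => [[_ [BS|->]]|[]] //; last by rewrite -eD.
by rewrite BS in nB.
Qed.

(** Matchings project by [pm_contract] and lift by [pm_lift]. The discarded edges lie inside [S],
    where [q] is constant, so none of them crosses the preimage of [T]. *)
Lemma tight_contract T : tight (fimage q F) T <-> tight F (q @^-1: T).
Proof.
split=> tT P pP.
  have nP B : B \in P -> 1 < #|B| by move/(pm_sub pP); exact: nsing.
  have crossQ B : B \in P -> crosses (q @^-1: T) B ->
      ~~ (B \subset S) /\ q @: B \in fimage q P.
    move=> BP cB; have nB : ~~ (B \subset S).
      apply/subsetP => BS; have [[x xB xT] [y yB yT]] := crossesP _ _ cB.
      by move: xT yT; rewrite !inE /q !proj_in ?BS // => ->.
    by split=> //; apply/(fimage_projP _ nP); exists B.
  have [D [/(fimage_projP _ nP)[C CP [-> nC]] cD uD]] :=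
    tight_crossing tT (pm_contract pP).
  exists C; apply/setP => B; rewrite !inE; apply/andP/eqP => [[BP cB]|->].
    have [nB QB] := crossQ B BP cB.
    by apply: (pm_proj_inj pP) => //; apply: uD; rewrite ?crosses_imset.
  by rewrite -crosses_imset.
have [P0 pP0 ->] := pm_lift pP.
have nP B : B \in P0 -> 1 < #|B| by move/(pm_sub pP0); exact: nsing.
have [C [CP cC uC]] := tight_crossing tT pP0.
exists (q @: C); apply/setP => D; rewrite !inE; apply/andP/eqP.
  by case=> /(fimage_projP _ nP)[B BP [-> _]]; rewrite crosses_imset => /(uC _ BP)->.
move=> ->; rewrite crosses_imset; split=> //.
apply/(fimage_projP _ nP); exists C => //; split=> //.
apply/subsetP => CS; have [[x xC xT] [y yC yT]] := crossesP _ _ cC.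
by move: xT yT; rewrite !inE /q !proj_in ?CS // => ->.
Qed.

Lemma good_contract : good Z (fimage q F).
Proof.
have [[P pP] eP _ con [w zw]] := gF; split.
- by exists (fimage q P); exact: pm_contract.
- move=> _ /(fimage_projP _ nsing)[B BF [-> nB]]; have [P0 pP0 BP] := eP B BF.
  exists (fimage q P0); first exact: pm_contract.
  apply/fimage_projP; last by exists B.
  by move=> E /(pm_sub pP0); exact: nsing.
- by move=> D; exact: fimage_card.
- move=> T T0 TT; have sq := proj_surj tight_set_neq0.
  have [||B BF cB] := con (q @^-1: T).
  + have /set0Pn[x xT] := T0; have [v qv] := sq x; apply/set0Pn.
    by exists v; rewrite inE /q qv.
  + apply: contra TT => /eqP/setP e; apply/eqP/setP => x; have [v <-] := sq x.
    by have := e v; rewrite !inE.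
  exists (q @: B); last by rewrite crosses_imset.
  apply/(fimage_projP _ nsing); exists B => //; split=> //.
  apply/subsetP => BS; have [[x xB xT] [y yB yT]] := crossesP _ _ cB.
  by move: xT yT; rewrite !inE /q !proj_in ?BS // => ->.
(* By [tight_wt] the new vertex receives exactly the weight of the part it replaces in any edge
   crossing [S], so partial sums of edges are unchanged. *)
pose w' (x : option {v | v \notin S}) := if x is Some v then w (val v) else wt w S.
exists w' => _ X /(fimage_projP _ nsing)[B BF [-> nB]] XB.
have -> : wt w' X = wt w (B :&: q @^-1: X).
  rewrite /wt (partition_big q (mem X)) /=; last by move=> v; rewrite !inE => /andP[].
  apply: eq_bigr => -[x|] xX.
    have := subsetP XB _ xX; rewrite mem_proj => xB.
    rewrite (big_pred1 (val x)) // => v; rewrite !inE /=.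
    apply/andP/eqP => [[_ /eqP]|->]; last by rewrite xB /q proj_val eqxx xX.
    by rewrite -proj_val => /proj_eq[//|[_]]; rewrite (negPf (valP x)).
  have := subsetP XB _ xX; rewrite mem_proj_None => nBS.
  have cB : crosses S B by rewrite /crosses nBS -setDE setD_eq0.
  rewrite /= -(tight_wt gF zw tS BF cB); apply: eq_bigl => v; rewrite !inE.
  have [vS|vS] := boolP (v \in S).
    by rewrite /q proj_in // xX eqxx !andbT.
  by rewrite /q proj_out !andbF.
rewrite (zw B) ?subsetIl //; congr (_ || _).
  apply/eqP/eqP => [e|->]; last by rewrite preimset0 setI0.
  apply/eqP; rewrite -subset0; apply/subsetP => x xX.
  have /imsetP[v vB ev] := subsetP XB _ xX.
  by have : v \in B :&: q @^-1: X; [rewrite !inE vB /q -ev | rewrite e inE].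
apply/eqP/eqP => [e|->].
  apply/eqP; rewrite eqEsubset XB /=; apply/subsetP => _ /imsetP[v vB ->].
  by move: vB; rewrite -e !inE => /andP[].
by apply/setIidPl/subsetP => v vB; rewrite inE imset_f.
Qed.

End TightContraction.

(** * Hypergraphs *)

Definition fam (H : hypergraph) : {set {set vert H}} := [set ends e | e : edge H].

Section Representatives.
Variable H : hypergraph.
Implicit Type e : edge H.

Lemma mem_fam e : ends e \in fam H.
Proof. exact: imset_f. Qed.

Lemma representative_exists e :
  exists2 e', parallel_representative e' & ends e' = ends e.
Proof.
have [e' /eqP ee' p] :
    exists2 e', ends e' == ends e & [pick e' | ends e' == ends e] = Some e'.
  by case: pickP => [e' ee'|/(_ e)]; [exists e' | rewrite eqxx].
by exists e'; rewrite // /parallel_representative ee' p.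
Qed.

Lemma representative_inj e e' :
  parallel_representative e -> parallel_representative e' ->
  ends e = ends e' -> e = e'.
Proof.
rewrite /parallel_representative => /eqP p /eqP p' ee'.
by move: p; rewrite ee' p' => -[].
Qed.

Lemma fam_representative (B : {set vert H}) : B \in fam H ->
  exists2 e, parallel_representative e & ends e = B.
Proof.
case/imsetP => e _ ->; have [e' r ee'] := representative_exists e.
by exists e'.
Qed.

End Representatives.

Lemma perfect_matching_pm (H : hypergraph) (M : {set edge H}) :
  perfect_matching M -> pm (fam H) [set ends e | e in M] /\
  forall e e' v, e \in M -> e' \in M -> v \in ends e -> v \in ends e' -> e = e'.
Proof.
move=> /forallP pM.
have cover v : exists2 e, e \in M & v \in ends e.
  have /cards1P[e ee] := pM v.
  by have := set11 e; rewrite -ee inE => /andP[eM ve]; exists e.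
have uM e e' v : e \in M -> e' \in M -> v \in ends e -> v \in ends e' -> e = e'.
  move=> eM e'M ve ve'; have /cards1P[e0 ee0] := pM v.
  have /set1P-> : e \in [set e0] by rewrite -ee0 inE eM.
  by have /set1P-> : e' \in [set e0] by rewrite -ee0 inE e'M.
split=> //; split.
- by apply/subsetP => _ /imsetP[e _ ->]; exact: mem_fam.
- by move=> v; have [e eM ve] := cover v; exists (ends e); rewrite ?imset_f.
- by move=> _ _ v /imsetP[e eM ->] /imsetP[e' e'M ->] ve ve'; rewrite (uM e e' v).
Qed.

(** A matching of sets lifts to one of edges by taking the representative of each parallel class.
    Conversely, a perfect matching of edges never contains two parallel edges, so counts of crossing
    edges agree. *)
Lemma perfect_matching_tight (H : hypergraph) (S : {set vert H}) :
  tight_cut S <-> tight (fam H) S.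
Proof.
split=> [/forallP tS P [/subsetP sPF cP uP]|tS].
  pose M := [set e | parallel_representative e && (ends e \in P)].
  have lift B : B \in P -> exists2 e, e \in M & ends e = B.
    move=> BP; have [e re eB] := fam_representative (sPF _ BP).
    by exists e; rewrite // inE re eB.
  have injM e e' : e \in M -> e' \in M -> ends e = ends e' -> e = e'.
    by rewrite !inE => /andP[re _] /andP[re' _]; exact: representative_inj.
  have pM : perfect_matching M.
    apply/forallP => v; have [B BP vB] := cP v; have [e eM eB] := lift B BP.
    apply/cards1P; exists e; apply/setP => e'; rewrite inE in_set1.
    apply/andP/eqP => [[e'M ve']|->]; last by rewrite eM eB.
    apply: injM => //; apply: (uP _ _ v) => //; last by rewrite eB.
      by move: e'M; rewrite inE => /andP[].
    by rewrite eB.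
  have /cards1P[c ec] : #|M :&: cut S| == 1 by have := tS M; rewrite pM.
  have : c \in M :&: cut S by rewrite ec set11.
  case/setIP => cM cc; exists (ends c); apply/setP => B; rewrite !inE.
  apply/andP/eqP => [[BP cB]|->]; last first.
    by move: cM cc; rewrite !inE /crosses => /andP[_ ->] ->.
  have [e eM eB] := lift B BP; rewrite -eB; congr ends.
  by apply/set1P; rewrite -ec inE eM inE -/(crosses S (ends e)) eB.
apply/forallP => M; apply/implyP => pM.
have [pP uM] := perfect_matching_pm pM.
have [C [/imsetP[c cM ->] cC uC]] := tight_crossing tS pP.
apply/cards1P; exists c; apply/setP => e; rewrite !inE -/(crosses S (ends e)).
apply/andP/eqP => [[eM ce]|->]; last by [].
have ee : ends e = ends c by apply: uC => //; exact: imset_f.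
have /set0Pn[v ve] := ends_neq0 e.
by apply: (uM e c v); rewrite // -ee.
Qed.

(** One-vertex edges are excluded because [fimage] would drop those outside [S], which [contract S]
    keeps. *)
Lemma fam_contract (H : hypergraph) (S : {set vert H}) :
  (forall B, B \in fam H -> 1 < #|B|) ->
  fam (contract S) = fimage (proj S) (fam H).
Proof.
move=> nF.
have eE (e : contract_edge S) : contract_ends e = proj S @: ends (val e).
  apply/setP => -[x|]; rewrite inE ?mem_proj // mem_proj_None.
  have := valP e; rewrite /= !inE -setDE setD_eq0.
  case: (set_0Vmem (ends (val e) :&: S)) => [->|[x /setIP[xe xS]]].
    by rewrite eqxx.
  have -> : ends (val e) :&: S != set0 by apply/set0Pn; exists x; rewrite inE xe.
  case/orP=> // /subsetP/(_ x xe); by rewrite inE xS.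
apply/setP => D; apply/imsetP/fimage_projP => //.
  case=> e _ ->; exists (ends (val e)); first exact: mem_fam.
  split; first exact: eE.
  have /set0Pn[x xe] := ends_neq0 (val e).
  have := valP e; rewrite /= => /orP[/subsetP/(_ x xe)|].
    by rewrite inE => xS; apply/subsetPn; exists x.
  by rewrite inE -setDE setD_eq0 => /andP[].
case=> _ /imsetP[e _ ->] [-> nS].
have eP : (ends e \subset ~: S) || (e \in cut S).
  rewrite inE -setDE setD_eq0 nS andbT -disjoints_subset -setI_eq0.
  exact: orbN.
by exists (exist _ e eP) => //; rewrite /= eE.
Qed.

Lemma ltn_sum_sub (V : finType) (n : V -> nat) (X B : {set V}) :
  (forall v, 0 < n v) -> X \subset B -> X != B ->
  \sum_(v in X) n v < \sum_(v in B) n v.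
Proof.
move=> n0 XB; rewrite eqEsubset XB /= => /subsetPn[y yB yX].
rewrite [ltnRHS](big_setID X) /= (setIidPr XB) -addn1 leq_add2l.
by rewrite (bigD1 y) ?inE ?yB ?yX //= ltn_addr.
Qed.

(** A proper nonempty part of an edge has integer weight strictly between zero and the common edge
    weight, hence a nonzero residue. *)
Lemma good_fam (H : hypergraph) :
  matching_covered H -> uniformable H -> 1 < #|vert H| ->
  exists Z : zmodType, good Z (fam H).
Proof.
case/and3P => /forallP con /card_gt0P[e0 _] /forallP eM [m [r [m1 mr]]] cV.
pose n v := `|m v|.
have nE v : m v = Posz (n v).
  by rewrite /n gez0_abs // (Order.POrderTheory.le_trans _ (m1 v)).
have n1 v : 0 < n v by have := m1 v; rewrite nE.
have nr B : B \in fam H -> \sum_(v in B) n v = `|r|.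
  case/imsetP => e _ ->; rewrite -(mr e); under [in RHS]eq_bigr do rewrite nE.
  by rewrite -(big_morph Posz PoszD (erefl (Posz 0))).
have conn (S : {set vert H}) : S != set0 -> S != setT ->
    exists2 B, B \in fam H & crosses S B.
  move=> /set0Pn[x xS] ST.
  have /subsetPn[y _ yS] : ~~ (setT \subset S) by rewrite subTset.
  have [/exists_inP[B BF cB]|/exists_inPn nc] := boolP [exists B in fam H, crosses S B].
    by exists B.
  have cl : closed (@adjacent H) (mem S).
    move=> u v /existsP[e /andP[ue ve]]; have ne := nc _ (mem_fam e).
    apply/idP/idP => h; apply: contraT => h'; case/negP: ne.
      exact: crossesI ue h ve h'.
    exact: crossesI ve h ue h'.
  have /forallP/(_ y) xy := con x.
  by have := closed_connect cl xy; rewrite /= xS (negPf yS).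
(* As there is a second vertex, connectedness gives an edge properly containing a one-vertex edge,
   contradicting equal edge weights. *)
have nsing (B : {set vert H}) : B \in fam H -> 1 < #|B|.
  move=> BF; rewrite ltnNge; apply/negP => cB.
  have [u uB] : exists u, u \in B.
    by apply/set0Pn; have /imsetP[e _ ->] := BF; exact: ends_neq0.
  have eu : B = [set u] by apply/eqP; rewrite eq_sym eqEcard sub1set uB cards1.
  have [||B' BF' /crossesP[[x xB' xu] [y yB' yu]]] := conn B.
  - by apply/set0Pn; exists u.
  - by apply/eqP => uT; move: cV; rewrite -cardsT -uT ltnNge cB.
  have : \sum_(v in B) n v < \sum_(v in B') n v.
    apply: ltn_sum_sub => //; last by apply: contraNneq yu => ->.
    by move: xu; rewrite eu sub1set => /set1P<-.
  by rewrite !nr // ltnn.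
(* ['Z_p] is the ring of residues modulo [p] only for [p] at least two. *)
have r1 : 1 < `|r|.
  have BF := mem_fam e0; have := nsing _ BF; rewrite -(nr _ BF).
  have /set0Pn[x xB] := ends_neq0 e0 => cB.
  have lt1 : \sum_(v in [set x]) n v < \sum_(v in ends e0) n v.
    apply: ltn_sum_sub; rewrite ?sub1set //.
    by apply: contraTneq cB => <-; rewrite cards1.
  by apply: leq_trans lt1; rewrite big_set1 ltnS.
have edgeP (B : {set vert H}) : B \in fam H -> exists2 P, pm (fam H) P & B \in P.
  case/imsetP => e _ ->; have /existsP[M /andP[pM eM']] := eM e.
  by exists [set ends e | e in M]; rewrite ?imset_f //; case: (perfect_matching_pm pM).
exists ('Z_(`|r|)); split=> //.
  by have [P pP _] := edgeP _ (mem_fam e0); exists P.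
exists (fun v => (n v)%:R%R) => B X BF XB; rewrite /wt -natr_sum.
have [->|X0] := eqVneq X set0; first by rewrite big_set0 eqxx.
have [->|nXB] := eqVneq X B; first by rewrite nr // -val_eqE /= val_Zp_nat // modnn.
rewrite -val_eqE /= val_Zp_nat // modn_small; last first.
  by rewrite -(nr B) // ltn_sum_sub.
have [x xX] := set0Pn _ X0.
by apply/negbTE; rewrite -lt0n (bigD1 x) //= ltn_addr.
Qed.

(** * Decompositions *)

Definition sim (G H : hypergraph) := fsim (fam G) (fam H).

Definition agree := SetoidPermutation.PermutationA sim.

Lemma sim_equivalence : Corelib.Classes.RelationClasses.Equivalence sim.
Proof.
split=> [G|G H|G H K]; [exact: fsim_refl | exact: fsim_sym | exact: fsim_trans].
Qed.

Lemma agree_refl L : agree L L.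
Proof.
elim: L => [|G L IH]; first exact: SetoidPermutation.permA_nil.
by apply: SetoidPermutation.permA_skip IH; exact: fsim_refl.
Qed.

Lemma agree_trans L1 L2 L3 : agree L1 L2 -> agree L2 L3 -> agree L1 L3.
Proof. exact: SetoidPermutation.permA_trans. Qed.

Lemma agree_sym L1 L2 : agree L1 L2 -> agree L2 L1.
Proof.
elim=> [|G H L L' GH _ IH|G H L|L L' L'' _ IH _ IH'].
- exact: SetoidPermutation.permA_nil.
- by apply: SetoidPermutation.permA_skip IH; exact: fsim_sym.
- exact: SetoidPermutation.permA_swap.
- exact: agree_trans IH' IH.
Qed.

Lemma agree_cat L1 L2 L1' L2' :
  agree L1 L1' -> agree L2 L2' -> agree (L1 ++ L2) (L1' ++ L2').
Proof.
move=> h1 h2; exact: (SetoidPermutation.PermutationA_app sim_equivalence h1 h2).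
Qed.

Lemma agree_catC L1 L2 : agree (L1 ++ L2) (L2 ++ L1).
Proof. exact: (SetoidPermutation.PermutationA_app_comm sim_equivalence). Qed.

(** The tree form of a run: the order in which different list members are treated is forgotten, and
    the list collects the leaves. *)
Inductive decomp (H : hypergraph) : seq hypergraph -> Prop :=
| DecompLeaf : ~~ has_nontrivial_tight_cut H -> decomp H [:: H]
| DecompNode (S : {set vert H}) (L1 L2 : seq hypergraph) :
    nontrivial_tight_cut S -> decomp (contract S) L1 ->
    decomp (contract (~: S)) L2 -> decomp H (L1 ++ L2).

Section Cuts.
Variables (Z : zmodType) (H : hypergraph).
Hypothesis gH : good Z (fam H).
Implicit Types S T : {set vert H}.

Lemma nontrivialP S :
  nontrivial_tight_cut S <->
  [/\ tight (fam H) S, 1 < #|S| & 1 < #|~: S|].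
Proof.
rewrite /nontrivial_tight_cut /trivial_cut negb_or.
split=> [/and3P[/perfect_matching_tight tS S1 S1']|[tS S1 S1']].
  split=> //; rewrite ltn_neqAle eq_sym ?S1 ?S1' card_gt0.
    exact: (tight_set_neq0 gH tS).
  exact: (tight_set_neq0 gH (tightC tS)).
by apply/and3P; split; [exact/perfect_matching_tight | rewrite gtn_eqF | rewrite gtn_eqF].
Qed.

Lemma nontrivialC S : nontrivial_tight_cut S -> nontrivial_tight_cut (~: S).
Proof.
move=> /nontrivialP[tS S1 S2]; apply/nontrivialP; rewrite setCK.
by split=> //; exact: tightC.
Qed.

Lemma good_card B : B \in fam H -> 1 < #|B|.
Proof. by case: gH => _ _ nF _ _; exact: nF. Qed.

Lemma fam_contractE S : fam (contract S) = fimage (proj S) (fam H).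
Proof. by apply: fam_contract => B; exact: good_card. Qed.

Lemma good_contraction S : nontrivial_tight_cut S -> good Z (fam (contract S)).
Proof.
by move=> /nontrivialP[tS _ _]; rewrite fam_contractE; exact: good_contract.
Qed.

Lemma card_contraction S : nontrivial_tight_cut S -> #|vert (contract S)| < #|vert H|.
Proof.
move=> /nontrivialP[_ S1 _]; rewrite /= card_option card_sig.
rewrite -(cardsC S) (_ : #|[pred x | x \notin S]| = #|~: S|).
  by have := ltn_add2r #|~: S| 1 #|S|; rewrite add1n S1.
by apply: eq_card => x; rewrite !inE.
Qed.

Lemma surj_nontrivial S : nontrivial_tight_cut S -> surj (proj S).
Proof.
by move=> /nontrivialP[tS _ _]; apply: proj_surj; exact: (tight_set_neq0 gH tS).
Qed.

End Cuts.

(** Contractions have fewer vertices. Existence is needed to pass through auxiliary cuts when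
    comparing two given ones. *)
Lemma decomp_exists Z H : good Z (fam H) -> exists L, decomp H L.
Proof.
have [n] := ubnP #|vert H|; elim: n H => // n IH H ltn gH.
have [/existsP[S nS]|nc] := boolP (has_nontrivial_tight_cut H); last first.
  by exists [:: H]; exact: DecompLeaf.
have [||L1 d1] := IH (contract S); last first.
- have nS' := nontrivialC gH nS.
  have [||L2 d2] := IH (contract (~: S)); last first.
  - by exists (L1 ++ L2); exact: DecompNode d1 d2.
  - exact: good_contraction.
  - exact: leq_trans (card_contraction gH nS') _.
- exact: good_contraction.
- exact: leq_trans (card_contraction gH nS) _.
Qed.

Lemma imset_bijC (V W : finType) (f : V -> W) (S : {set V}) :
  bijective f -> f @: (~: S) = ~: (f @: S).
Proof.
case=> g fK gK; apply/setP => y; rewrite inE -[y]gK !mem_imset ?inE //;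
exact: can_inj fK.
Qed.

Lemma fsim_tight (V W : finType) (F : {set {set V}}) (G : {set {set W}}) f S :
  bijective f -> (forall D : {set V}, (f @: D \in G) = (D \in F)) ->
  tight F S -> tight G (f @: S).
Proof.
case=> g fK gK fG tS P [/subsetP sPG cP uP].
have fg (B : {set W}) : f @: (g @: B) = B by rewrite -imset_comp (eq_imset _ gK) imset_id.
have gf (B : {set V}) : g @: (f @: B) = B by rewrite -imset_comp (eq_imset _ fK) imset_id.
have ig := can_inj gK.
have mg y (B : {set W}) : (g y \in g @: B) = (y \in B) by exact: mem_imset.
pose P0 := [set g @: B | B : {set W} in P].
have pP0 : pm F P0.
  split.
  - by apply/subsetP => _ /imsetP[B BP ->]; rewrite -fG fg sPG.
  - move=> v; have [B BP vB] := cP (f v); exists (g @: B); first exact: imset_f.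
    by rewrite -[v]fK mg.
  - move=> _ _ v /imsetP[B BP ->] /imsetP[B' BP' ->]; rewrite -[v]fK !mg => vB vB'.
    by rewrite (uP _ _ _ BP BP' vB vB').
have [C [/imsetP[B BP ->] cB uB]] := tight_crossing tS pP0.
have cr B' : crosses (f @: S) B' = crosses S (g @: B').
  rewrite crosses_imset; congr (crosses _ B'); apply/setP => y.
  by rewrite inE -{1}[y]gK mem_imset //; exact: can_inj fK.
exists B; apply/setP => B'; rewrite !inE cr; apply/andP/eqP => [[BP' cB']|->] //.
have e : g @: B' = g @: B by apply: uB => //; exact: imset_f.
by rewrite -[B']fg e fg.
Qed.

Lemma fsim_nontrivial (G H : hypergraph) (f : vert G -> vert H) S :
  bijective f -> (forall D : {set vert G}, (f @: D \in fam H) = (D \in fam G)) ->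
  nontrivial_tight_cut S -> nontrivial_tight_cut (f @: S).
Proof.
move=> bf fG; rewrite /nontrivial_tight_cut /trivial_cut => /andP[tS nS].
rewrite -(imset_bijC _ bf) !card_imset ?nS ?andbT; do ?exact: bij_inj.
by apply/perfect_matching_tight/(fsim_tight bf fG)/perfect_matching_tight.
Qed.

Lemma fsim_contract (V W : finType) (F : {set {set V}}) (G : {set {set W}})
    f (S : {set V}) :
  (forall B, B \in F -> 1 < #|B|) -> S != set0 ->
  bijective f -> (forall D : {set V}, (f @: D \in G) = (D \in F)) ->
  fsim (fimage (proj S) F) (fimage (proj (f @: S)) G).
Proof.
move=> nF S0 bf fG; have injf := bij_inj bf.
have -> : G = fimage f F.
  rewrite fimage_inj //; apply/setP => D; have [g fK gK] := bf.
  have eD : D = f @: (g @: D) by rewrite -imset_comp (eq_imset _ gK) imset_id.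
  by rewrite eD fG (mem_imset _ _ (imset_inj injf)).
rewrite fimage_comp; apply: fsim_kernel; first exact: proj_surj.
  move=> x; have [|y <-] := @proj_surj _ (f @: S) _ x.
    by have /set0Pn[z zS] := S0; apply/set0Pn; exists (f z); rewrite imset_f.
  by have [g _ gK] := bf; exists (g y); rewrite /= gK.
move=> x y; split=> [/proj_eq|/= /proj_eq]; rewrite /= ?(mem_imset _ _ injf).
  by case=> [->//|[xS yS]]; apply/proj_eq; right; rewrite !imset_f.
by case=> [/injf->//|h]; apply/proj_eq; right.
Qed.

Lemma sim_contract Z (G H : hypergraph) (f : vert G -> vert H) (S : {set vert G}) :
  good Z (fam G) -> bijective f ->
  (forall D : {set vert G}, (f @: D \in fam H) = (D \in fam G)) ->
  nontrivial_tight_cut S -> sim (contract S) (contract (f @: S)).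
Proof.
move=> gG bf fG nS; rewrite /sim (fam_contractE gG) fam_contract.
  apply: fsim_contract => //; first by move=> B; exact: (good_card gG).
  by have /(nontrivialP gG)[tS _ _] := nS; exact: (tight_set_neq0 gG tS).
move=> B; have [g fK gK] := bf.
have -> : B = f @: (g @: B) by rewrite -imset_comp (eq_imset _ gK) imset_id.
by rewrite fG card_imset; [exact: (good_card gG) | exact: bij_inj].
Qed.

(** All cuts of the tree are moved along the bijection. Contractions reached in different ways are
    only similar, never literally equal, so the induction hypothesis is applied after such a
    transport. *)
Lemma decomp_sim Z G H L : good Z (fam G) -> sim G H -> decomp G L ->
  exists2 L', decomp H L' & agree L L'.
Proof.
move=> gG sGH dG; elim: dG gG H sGH => {G L} [G nG|G S L1 L2 nS _ IH1 _ IH2] gG H sGH.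
  exists [:: H].
    apply: DecompLeaf; apply: contra nG => /existsP[T nT].
    have [f bf fE] := fsim_sym sGH; apply/existsP; exists (f @: T).
    exact: fsim_nontrivial nT.
  exact: SetoidPermutation.permA_skip sGH (SetoidPermutation.permA_nil _).
have [f bf fE] := sGH; have nS' := nontrivialC gG nS.
have [L1' d1 a1] := IH1 (good_contraction gG nS) _ (sim_contract gG bf fE nS).
have [L2' d2 a2] := IH2 (good_contraction gG nS') _ (sim_contract gG bf fE nS').
exists (L1' ++ L2'); last exact: agree_cat.
apply: DecompNode d1 _; first exact: fsim_nontrivial nS.
by rewrite -imset_bijC.
Qed.

(** * Contractions compared through collapses *)

Section Collapse.
Variables (V : finType) (S T : {set V}) (u v : V).
Hypotheses (eu : S :&: T = [set u]) (ev : ~: S :&: ~: T = [set v]).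

Lemma collapse_eq x y :
  proj S x = proj S y <-> collapse S u x = collapse S u y.
Proof.
have /setIP[uS _] : u \in S :&: T by rewrite eu set11.
split=> [/proj_eq[->//|[xS yS]]|]; first by rewrite /collapse xS yS.
rewrite /collapse => e; apply/proj_eq; move: e.
case: ifPn => xS; case: ifPn => yS; first by right.
- by move=> e; rewrite -e uS in yS.
- by move=> e; rewrite e uS in xS.
- by left.
Qed.

(** The ranges are [~: S] with [u] and [T] with [v]; both amount to [~: S :&: T] with [u] and
    [v]. *)
Lemma collapse_range x : exists x', collapse (~: T) v x' = collapse S u x.
Proof.
have /setIP[uS uT] : u \in S :&: T by rewrite eu set11.
rewrite {2}/collapse; case: ifPn => xS.
  by exists u; rewrite /collapse inE uT.
exists x; rewrite /collapse inE; case: ifPn => // xT.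
by apply/esym/eqP; rewrite -in_set1 -ev !inE xS.
Qed.

End Collapse.

Lemma corners_swap (V : finType) (S T : {set V}) u v :
  S :&: T = [set u] -> ~: S :&: ~: T = [set v] ->
  ~: T :&: ~: S = [set v] /\ ~: ~: T :&: ~: ~: S = [set u].
Proof. by move=> eu ev; split; rewrite setIC // !setCK. Qed.

Lemma sim_corner Z (H : hypergraph) (S T : {set vert H}) u v :
  good Z (fam H) -> nontrivial_tight_cut S -> nontrivial_tight_cut T ->
  S :&: T = [set u] -> ~: S :&: ~: T = [set v] ->
  fimage (collapse S u) (fam H) = fimage (collapse (~: T) v) (fam H) ->
  sim (contract S) (contract (~: T)).
Proof.
move=> gH nS nT eu ev e; have [ev' eu'] := corners_swap eu ev.
rewrite /sim !(fam_contractE gH); apply: fsim_fimage e.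
- exact: (surj_nontrivial gH nS).
- exact: (surj_nontrivial gH (nontrivialC gH nT)).
- exact: (collapse_eq eu).
- exact: (collapse_eq ev').
- exact: (collapse_range eu ev).
- by move=> x; have := collapse_range ev' eu' x; rewrite setCK.
Qed.

(** * The induction step: independence of the first cut *)

Section Uniqueness.
Variables (Z : zmodType) (H : hypergraph).
Hypothesis gH : good Z (fam H).
Hypothesis IH : forall G, #|vert G| < #|vert H| -> good Z (fam G) ->
  forall L L', decomp G L -> decomp G L' -> agree L L'.
Implicit Types S T X : {set vert H}.

Lemma smaller_unique G G' L L' : #|vert G| < #|vert H| ->
  good Z (fam G) -> good Z (fam G') -> sim G' G ->
  decomp G L -> decomp G' L' -> agree L L'.
Proof.
move=> cG gG gG' s d d'; have [L'' d'' a] := decomp_sim gG' s d'.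
exact: agree_trans (IH cG gG d d'') (agree_sym a).
Qed.

Lemma contraction_unique S G L L' : nontrivial_tight_cut S ->
  good Z (fam G) -> sim G (contract S) ->
  decomp (contract S) L -> decomp G L' -> agree L L'.
Proof.
move=> nS gG s d d'; have gS := good_contraction gH nS.
exact: (smaller_unique (card_contraction gH nS) gS gG s d d').
Qed.

(** Starting with [S] or with [T] makes no difference. Quantifying over all decompositions allows
    chaining through a third cut. *)
Definition joined S T := forall L1 L2 L1' L2',
  decomp (contract S) L1 -> decomp (contract (~: S)) L2 ->
  decomp (contract T) L1' -> decomp (contract (~: T)) L2' ->
  agree (L1 ++ L2) (L1' ++ L2').

Lemma joined_trans S T X : nontrivial_tight_cut T ->
  joined S T -> joined T X -> joined S X.
Proof.
move=> nT ST TX L1 L2 L1' L2' d1 d2 d1' d2'.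
have [M1 e1] := decomp_exists (good_contraction gH nT).
have [M2 e2] := decomp_exists (good_contraction gH (nontrivialC gH nT)).
exact: agree_trans (ST _ _ _ _ d1 d2 e1 e2) (TX _ _ _ _ e1 e2 d1' d2').
Qed.

Lemma joined_sims S T : nontrivial_tight_cut S -> nontrivial_tight_cut T ->
  sim (contract S) (contract (~: T)) -> sim (contract (~: S)) (contract T) ->
  joined S T.
Proof.
move=> nS nT s1 s2 L1 L2 L1' L2' d1 d2 d1' d2'.
have nCS := nontrivialC gH nS; have nCT := nontrivialC gH nT.
apply: agree_trans (agree_catC L2' L1'); apply: agree_cat.
  exact: (contraction_unique nS (good_contraction gH nCT) (fsim_sym s1) d1 d2').
exact: (contraction_unique nCS (good_contraction gH nT) (fsim_sym s2) d2 d1').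
Qed.

Lemma joinedC S : nontrivial_tight_cut S -> joined S (~: S).
Proof.
move=> nS; apply: joined_sims => //; first exact: (nontrivialC gH nS).
  by rewrite setCK; exact: fsim_refl.
exact: fsim_refl.
Qed.

Lemma mem_proj_disjoint S T x : S :&: T = set0 ->
  (proj S x \in proj S @: T) = (x \in T).
Proof.
move=> ST; have [xS|xS] := boolP (x \in S).
  rewrite (proj_in xS) mem_proj_None setIC ST eqxx.
  by apply/esym/negP => xT; have : x \in S :&: T; [rewrite inE xS | rewrite ST inE].
by rewrite (proj_out xS) mem_proj.
Qed.

Lemma preim_proj S T : S :&: T = set0 -> proj S @^-1: (proj S @: T) = T.
Proof. by move=> ST; apply/setP => x; rewrite inE mem_proj_disjoint. Qed.

(** By disjointness [T] is the preimage of its image, so tightness descends. A vertex outside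
    [S :|: T] joins the new vertex on the other side, making that side nontrivial. *)
Lemma nontrivial_proj S T : nontrivial_tight_cut S -> nontrivial_tight_cut T ->
  S :&: T = set0 -> S :|: T != setT ->
  @nontrivial_tight_cut (contract S) (proj S @: T).
Proof.
move=> nS nT ST; rewrite -subTset => /subsetPn[z _]; rewrite inE negb_or => /andP[zS zT].
have [tS S1 _] := (nontrivialP gH S).1 nS; have [tT T1 _] := (nontrivialP gH T).1 nT.
apply/(nontrivialP (good_contraction gH nS)); split.
- by rewrite (fam_contractE gH); apply/(tight_contract gH tS); rewrite preim_proj.
- rewrite card_proj //; apply/subsetPn; have [x xT] := set0Pn _ (tight_set_neq0 gH tT).
  exists x => //; apply/negP => xS.
  by have : x \in S :&: T; [rewrite inE xS | rewrite ST inE].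
have [s sS] := set0Pn _ (tight_set_neq0 gH tS).
have sT : s \notin T.
  by apply/negP => sT; have : s \in S :&: T; [rewrite inE sS | rewrite ST inE].
have <- : #|[set proj S s; proj S z]| = 2 by rewrite cards2 proj_in // proj_out.
apply/subset_leq_card/subsetP => x; rewrite in_set2 inE.
have out y : y \notin T -> proj S y \notin proj S @: T by rewrite mem_proj_disjoint.
by case/orP => /eqP->; exact: out.
Qed.

Lemma fam_contract2 S (T' : {set vert (contract S)}) : nontrivial_tight_cut S ->
  fam (contract T') = fimage (proj T' \o proj S) (fam H).
Proof.
move=> nS; rewrite (fam_contractE (good_contraction gH nS)) (fam_contractE gH).
exact: fimage_comp.
Qed.

Lemma surj_comp (U V W : finType) (p : V -> W) (q : U -> V) :
  surj p -> surj q -> surj (p \o q).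
Proof. by move=> sp sq x; have [y <-] := sp x; have [z <-] := sq y; exists z. Qed.

(** Contracting [S] and [T] in either order identifies the same vertices. Contracting the complement
    of [T'] swallows the vertex that replaced [S], so the result is that of contracting [~: T] at
    once. *)
Lemma sim_contract2 S T : nontrivial_tight_cut S -> nontrivial_tight_cut T ->
  S :&: T = set0 -> S :|: T != setT ->
  let S' := proj T @: S : {set vert (contract T)} in
  let T' := proj S @: T : {set vert (contract S)} in
  sim (contract T') (contract S') /\ sim (contract (~: T')) (contract (~: T)).
Proof.
move=> nS nT ST STT S' T'; have TS : T :&: S = set0 by rewrite setIC.
have nT' := nontrivial_proj nS nT ST STT.
have nS' : nontrivial_tight_cut S' by apply: nontrivial_proj => //; rewrite setUC.
have gS := good_contraction gH nS; have gT := good_contraction gH nT.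
have sS := surj_nontrivial gH nS; have sT := surj_nontrivial gH nT.
split; rewrite /sim.
  rewrite !fam_contract2 //; apply: fsim_kernel.
  - exact: (surj_comp (surj_nontrivial gS nT') sS).
  - exact: (surj_comp (surj_nontrivial gT nS') sT).
  move=> x y /=; split=> /proj_eq; rewrite !mem_proj_disjoint // => h; apply/proj_eq;
    rewrite !mem_proj_disjoint //; case: h => [/proj_eq[->|h]|h]; auto;
    by left; apply/proj_eq; right.
rewrite fam_contract2 // (fam_contractE gH); apply: fsim_kernel.
- exact: (surj_comp (surj_nontrivial gS (nontrivialC gS nT')) sS).
- exact: (surj_nontrivial gH (nontrivialC gH nT)).
have out x : x \in S -> x \notin T.
  by move=> xS; apply/negP => xT; have : x \in S :&: T; [rewrite inE xS | rewrite ST inE].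
have memT x : (proj S x \in ~: T') = (x \notin T).
  by rewrite inE; congr (~~ _); exact: mem_proj_disjoint.
move=> x y /=; split=> /proj_eq; rewrite ?memT.
  case=> [/proj_eq[->//|[xS yS]]|h]; apply/proj_eq; right; rewrite !inE //.
  by rewrite !out.
by rewrite !inE; case=> [->//|h]; apply/proj_eq; right; rewrite !memT.
Qed.

(** Using the other cut second, both sides split into the same three pieces: [S] and [T] both
    contracted, [contract (~: S)] and [contract (~: T)]. *)
Lemma joined_disjoint S T : nontrivial_tight_cut S -> nontrivial_tight_cut T ->
  S :&: T = set0 -> joined S T.
Proof.
move=> nS nT ST; have [STT|STT] := eqVneq (S :|: T) setT.
  suff -> : T = ~: S by exact: joinedC.
  apply/setP => x; have := in_setT x; rewrite -STT !inE.
  have [xS _|//] := boolP (x \in S); apply/negP => xT.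
  by have : x \in S :&: T; [rewrite inE xS | rewrite ST inE].
have TS : T :&: S = set0 by rewrite setIC.
have TST : T :|: S != setT by rewrite setUC.
have [s12 s3] := sim_contract2 nS nT ST STT.
have [s21 s4] := sim_contract2 nT nS TS TST.
have nT' := nontrivial_proj nS nT ST STT; have nS' := nontrivial_proj nT nS TS TST.
move=> L1 L2 L1' L2' d1 d2 d1' d2'.
have gS := good_contraction gH nS; have gT := good_contraction gH nT.
have [A dA] := decomp_exists (good_contraction gS nT').
have [B dB] := decomp_exists (good_contraction gS (nontrivialC gS nT')).
have [A' dA'] := decomp_exists (good_contraction gT nS').
have [B' dB'] := decomp_exists (good_contraction gT (nontrivialC gT nS')).
have a1 : agree L1 (A ++ B).
  by apply: IH d1 (DecompNode nT' dA dB); rewrite ?(card_contraction gH).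
have a1' : agree L1' (A' ++ B').
  by apply: IH d1' (DecompNode nS' dA' dB'); rewrite ?(card_contraction gH).
have aA : agree A A'.
  apply: (smaller_unique _ (good_contraction gS nT') (good_contraction gT nS')
    (fsim_sym s12) dA dA').
  exact: ltn_trans (card_contraction gS nT') (card_contraction gH nS).
have a2 : agree L2 B'.
  exact: (contraction_unique (nontrivialC gH nS)
    (good_contraction gT (nontrivialC gT nS')) s4 d2 dB').
have a2' : agree L2' B.
  exact: (contraction_unique (nontrivialC gH nT)
    (good_contraction gS (nontrivialC gS nT')) s3 d2' dB).
apply: agree_trans (agree_cat a1 a2) _; rewrite -catA.
apply: agree_trans (agree_sym (agree_cat a1' a2')); rewrite -catA.
by apply: agree_cat aA _; exact: agree_catC.
Qed.

Lemma joined_subset S T : nontrivial_tight_cut S -> nontrivial_tight_cut T ->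
  S \subset T -> joined S T.
Proof.
move=> nS nT ST; apply: (joined_trans (nontrivialC gH nT)).
  apply: joined_disjoint; rewrite ?(nontrivialC gH) //.
  by apply/eqP; rewrite -setDE setD_eq0.
rewrite -{2}[T]setCK; exact: (joinedC (nontrivialC gH nT)).
Qed.

Lemma joined_sym S T : joined S T -> joined T S.
Proof. by move=> ST L1 L2 L1' L2' d1 d2 d1' d2'; apply: agree_sym; exact: ST. Qed.

(** The corner is a nontrivial tight cut nested in both [S] and [T], so the chain passes through
    it. *)
Lemma joined_setI S T : nontrivial_tight_cut S -> nontrivial_tight_cut T ->
  tight (fam H) (S :&: T) -> #|S :&: T| != 1 -> joined S T.
Proof.
move=> nS nT tI cI; have [tS S1 S2] := (nontrivialP gH S).1 nS.
have nI : nontrivial_tight_cut (S :&: T).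
  apply/(nontrivialP gH); split=> //.
    by rewrite ltn_neqAle eq_sym cI card_gt0 (tight_set_neq0 gH tI).
  by apply: leq_trans S2 _; rewrite subset_leq_card // setCS subsetIl.
apply: (joined_trans nI); last exact: (joined_subset nI nT (subsetIr _ _)).
by apply: joined_sym; exact: (joined_subset nI nS (subsetIl _ _)).
Qed.

Lemma joined_setCC S T : nontrivial_tight_cut S -> nontrivial_tight_cut T ->
  joined (~: S) (~: T) -> joined S T.
Proof.
move=> nS nT h; have nCS := nontrivialC gH nS; have nCT := nontrivialC gH nT.
apply: (joined_trans nCS (joinedC nS)); apply: (joined_trans nCT h).
by rewrite -{2}[T]setCK; exact: joinedC.
Qed.

Lemma joined_setC S T : nontrivial_tight_cut S -> nontrivial_tight_cut T ->
  joined S (~: T) -> joined S T.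
Proof.
move=> nS nT h; have nCT := nontrivialC gH nT; apply: (joined_trans nCT h).
by rewrite -{2}[T]setCK; exact: joinedC.
Qed.

Lemma joined_corners S T u v : nontrivial_tight_cut S -> nontrivial_tight_cut T ->
  S :&: T = [set u] -> ~: S :&: ~: T = [set v] ->
  fimage (collapse S u) (fam H) = fimage (collapse (~: T) v) (fam H) ->
  fimage (collapse (~: S) v) (fam H) = fimage (collapse (~: ~: T) u) (fam H) ->
  joined S T.
Proof.
move=> nS nT eu ev e1 e2; apply: joined_sims => //.
  exact: (sim_corner gH nS nT eu ev).
have eu' : ~: ~: S :&: ~: ~: T = [set u] by rewrite !setCK.
by have := sim_corner gH (nontrivialC gH nS) (nontrivialC gH nT) ev eu' e2; rewrite setCK.
Qed.

(** [uncrossing] makes two opposite corners tight. The chain passes through one of them that is not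
    a single vertex; if both are, [collapse_corner] matches the contractions crosswise. *)
Lemma joined_uncrossed (w : vert H -> Z) S T : zero_sum (fam H) w ->
  nontrivial_tight_cut S -> nontrivial_tight_cut T ->
  wt w (S :&: T) = wt w S \/ wt w (S :&: T) = wt w T -> joined S T.
Proof.
move=> zw nS nT ab; have nCS := nontrivialC gH nS; have nCT := nontrivialC gH nT.
have [tS S1 S2] := (nontrivialP gH S).1 nS; have [tT T1 T2] := (nontrivialP gH T).1 nT.
have [tI tI'] := uncrossing gH zw tS tT ab.
have [c1|c1] := eqVneq #|S :&: T| 1; last exact: joined_setI.
have [c2|c2] := eqVneq #|~: S :&: ~: T| 1; last first.
  by apply: joined_setCC => //; exact: joined_setI.
have /cards1P[u eu] : #|S :&: T| == 1 by apply/eqP.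
have /cards1P[v ev] : #|~: S :&: ~: T| == 1 by apply/eqP.
have neq1 (X : {set vert H}) x : 1 < #|X| -> X != [set x].
  by apply: contraTneq => ->; rewrite cards1.
have ab' : wt w (~: S :&: ~: T) = wt w (~: S) \/ wt w (~: S :&: ~: T) = wt w (~: T).
  rewrite (wt_setCI S T gH zw) !(wtC _ gH zw).
  by case: ab => ->; [right; rewrite subrr add0r | left; rewrite addrAC subrr add0r].
apply: (joined_corners nS nT eu ev).
  by apply: (collapse_corner gH zw); rewrite ?neq1 //; move: ab; rewrite eu /wt !big_set1.
apply: (collapse_corner gH zw); rewrite ?neq1 ?setCK //; try exact: tightC.
by move: ab'; rewrite ev {1 3}/wt !big_set1.
Qed.

Lemma joined_all S T : nontrivial_tight_cut S -> nontrivial_tight_cut T -> joined S T.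
Proof.
move=> nS nT; have [_ _ _ _ [w zw]] := gH.
have nCS := nontrivialC gH nS; have nCT := nontrivialC gH nT.
have [tS S1 S2] := (nontrivialP gH S).1 nS; have [tT T1 T2] := (nontrivialP gH T).1 nT.
have [a|na] := eqVneq (wt w (S :&: T)) (wt w S).
  by apply: (joined_uncrossed zw) => //; left.
have [b|nb] := eqVneq (wt w (S :&: T)) (wt w T).
  by apply: (joined_uncrossed zw) => //; right.
have eD : wt w (S :&: ~: T) = (wt w S - wt w (S :&: T))%R.
  by rewrite [wt w S](wtID w S T) addrC addKr.
(* In this case and the next, replacing [T] by its complement leads back to [joined_uncrossed]. *)
have [x0|n0] := eqVneq (wt w (S :&: T)) 0%R.
  apply: joined_setC => //; apply: (joined_uncrossed zw) => //; left.
  by rewrite eD x0 subr0.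
have [xD|nD] := eqVneq (wt w (S :&: T)) (wt w S + wt w T)%R.
  apply: joined_setC => //; apply: (joined_uncrossed zw) => //; right.
  by rewrite eD xD opprD addrA subrr add0r (wtC _ gH zw).
(* For a generic value all corners are tight: complementing one cut turns the forbidden values zero
   and [wt w S + wt w T] into [wt w S] and [wt w T], excluded above. *)
have tI := tight_setI gH zw tS tT n0 nD.
have [c1|c1] := eqVneq #|S :&: T| 1; last exact: joined_setI.
have tI1 : tight (fam H) (S :&: ~: T).
  apply: (tight_setI gH zw tS (tightC tT)); rewrite eD.
    by rewrite subr_eq0 eq_sym.
  by rewrite (wtC _ gH zw) (inj_eq (addrI _)) eqr_opp.
have [c2|c2] := eqVneq #|S :&: ~: T| 1; last first.
  by apply: joined_setC => //; exact: joined_setI.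
have eD' : wt w (~: S :&: T) = (wt w T - wt w (S :&: T))%R.
  by rewrite [wt w T](wtID w T S) (setIC T S) addrC addKr setIC.
have tI2 : tight (fam H) (~: S :&: T).
  apply: (tight_setI gH zw (tightC tS) tT); rewrite eD'.
    by rewrite subr_eq0 eq_sym.
  by rewrite (wtC _ gH zw) addrC (inj_eq (addIr _)) eqr_opp.
have [c3|c3] := eqVneq #|~: S :&: T| 1; last first.
  by apply: joined_setCC => //; apply: joined_setC; rewrite ?setCK //; exact: joined_setI.
have tI3 : tight (fam H) (~: S :&: ~: T).
  apply: (tight_setI gH zw (tightC tS) (tightC tT)); rewrite (wt_setCI S T gH zw).
    by rewrite -addrA -opprD subr_eq0.
  by rewrite !(wtC _ gH zw) -addrA -subr_eq0 addrK.
have [c4|c4] := eqVneq #|~: S :&: ~: T| 1; last first.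
  by apply: joined_setCC => //; exact: joined_setI.
have cS : #|S| = 2 by rewrite -(cardsID T) setDE c1 c2.
have cS' : #|~: S| = 2 by rewrite -(cardsID T) setDE c3 c4.
have /cards1P[u eu] : #|S :&: T| == 1 by apply/eqP.
have /cards1P[v ev] : #|~: S :&: ~: T| == 1 by apply/eqP.
have full B : B \in fam H -> B = setT := tight_halves gH tS cS cS'.
(* Every edge is the whole vertex set, so its image is the range of the map, and only ranges have to
   be compared. *)
have collapsed (p q : vert H -> vert H) :
    (forall x, exists x', q x' = p x) -> (forall x, exists x', p x' = q x) ->
    fimage p (fam H) = fimage q (fam H).
  move=> pq qp; have e : p @: setT = q @: setT.
    apply/setP => x; apply/imsetP/imsetP => -[y _ ->].
      by have [y' <-] := pq y; exists y'.
    by have [y' <-] := qp y; exists y'.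
  apply/setP => D; apply/fimageP/fimageP => -[B BF [-> cB]]; exists B => //.
    by split=> //; rewrite (full _ BF).
  by split=> //; rewrite (full _ BF).
have [ev' eu'] := corners_swap eu ev.
apply: (joined_corners nS nT eu ev); apply: collapsed.
- exact: (collapse_range eu ev).
- by move=> x; have := collapse_range ev' eu' x; rewrite setCK.
- apply: (collapse_range ev); by rewrite !setCK.
- have := @collapse_range _ T S u v; rewrite (setIC T) (setIC (~: T)) setCK => h.
  exact: h.
Qed.

Lemma decomp_unique_step L L' : decomp H L -> decomp H L' -> agree L L'.
Proof.
case=> [nc|S L1 L2 nS d1 d2]; case=> [nc'|T L1' L2' nT d1' d2'].
- exact: agree_refl.
- by case/negP: nc; apply/existsP; exists T.
- by case/negP: nc'; apply/existsP; exists S.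
- exact: (joined_all nS nT d1 d2 d1' d2').
Qed.

End Uniqueness.

Lemma decomp_unique Z H L L' :
  good Z (fam H) -> decomp H L -> decomp H L' -> agree L L'.
Proof.
have [n] := ubnP #|vert H|; elim: n H L L' => // n IH H L L' ltn gH.
apply: (decomp_unique_step gH) => G cG gG M M'; apply: IH => //.
exact: leq_trans cG ltn.
Qed.

(** * Runs of the procedure *)

Inductive decomps : seq hypergraph -> seq hypergraph -> Prop :=
| DecompsNil : decomps [::] [::]
| DecompsCons G L Gs Ls :
    decomp G L -> decomps Gs Ls -> decomps (G :: Gs) (L ++ Ls).

Lemma decomps_leaves L : ~~ has has_nontrivial_tight_cut L -> decomps L L.
Proof.
elim: L => [|G L IH] /=; first by move=> _; exact: DecompsNil.
rewrite negb_or => /andP[nG nL].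
exact: (DecompsCons (DecompLeaf nG) (IH nL)).
Qed.

(** The run is read from its end: the output consists of leaves, and undoing a step merges two
    neighbouring trees under one node. *)
Lemma decomps_step L0 L1 L :
  decomposition_step L0 L1 -> decomps L1 L -> decomps L0 L.
Proof.
case=> K1 K2 G S nS; elim: K1 L => [|K K1 IH] L /= d; inversion_clear d.
  inversion_clear H0; rewrite catA; apply: DecompsCons => //; exact: DecompNode nS _ _.
by apply: DecompsCons => //; exact: IH.
Qed.

Lemma output_decomp H L : decomposition_output H L -> decomp H L.
Proof.
case=> run fin; have d : decomps [:: H] L.
  elim: run fin => [K|K0 K1 K2 s _ IH /IH]; first exact: decomps_leaves.
  exact: decomps_step s.
inversion_clear d; inversion_clear H1; by rewrite cats0.
Qed.

(** Covers what [good_fam] leaves out: with a single vertex, one side of every cut has exactly one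
    element. *)
Lemma small_no_cut (H : hypergraph) :
  0 < #|edge H| -> #|vert H| <= 1 -> ~~ has_nontrivial_tight_cut H.
Proof.
case/card_gt0P => e _ cV; have /set0Pn[v _] := ends_neq0 e.
have {}cV : #|vert H| = 1.
  by apply/eqP; rewrite eqn_leq cV; apply/card_gt0P; exists v.
apply/existsPn => S; rewrite negb_and negbK orbC /trivial_cut.
by have := cardsC S; rewrite cV; case: #|S| => [|[|k]] //; rewrite add0n => ->.
Qed.

(** * From permuted lists to an isomorphism for each index *)

Section Matching.
Variables (T : Type) (R : T -> T -> Prop) (x0 : T).

(** The maps are on [nat] and mutually inverse only within range, so that the induction avoids
    ordinals of changing bounds. *)
Lemma PermutationA_nth L L' : SetoidPermutation.PermutationA R L L' ->
  (forall x, R x x) -> (forall x y z, R x y -> R y z -> R x z) ->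
  exists phi psi : nat -> nat,
    [/\ size L = size L',
        forall i, i < size L -> phi i < size L' /\ psi (phi i) = i,
        forall j, j < size L' -> psi j < size L /\ phi (psi j) = j
      & forall i, i < size L -> R (nth x0 L i) (nth x0 L' (phi i))].
Proof.
move=> p refl trans; elim: p => {L L'} [|x y L L' xy _|x y L|L1 L2 L3 _ IH1 _ IH2].
- by exists id, id; split.
- move=> [phi [psi [sz h1 h2 h3]]].
  exists (fun i => if i is k.+1 then (phi k).+1 else 0),
         (fun j => if j is k.+1 then (psi k).+1 else 0).
  split=> [|[|i]|[|j]|[|i]] //=; first by rewrite sz.
  + by rewrite ltnS => /h1[? ->].
  + by rewrite ltnS => /h2[? ->].
  + by rewrite ltnS => /h3.
- pose t i := match i with 0 => 1 | 1 => 0 | _ => i end.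
  by exists t, t; split=> // -[|[|i]] //=.
have [phi [psi [sz h1 h2 h3]]] := IH1; have [phi' [psi' [sz' h1' h2' h3']]] := IH2.
exists (phi' \o phi), (psi \o psi'); split=> [|i iL|j jL|i iL] /=.
- by rewrite sz.
- have [lt e] := h1 i iL; have [lt' e'] := h1' _ lt; by rewrite e' e.
- have [lt e] := h2' j jL; have [lt' e'] := h2 _ lt; by rewrite e' e.
have [lt e] := h1 i iL; exact: trans (h3 i iL) (h3' _ lt).
Qed.

End Matching.

Lemma sim_simplify_embedding (G H : hypergraph) (f : vert G -> vert H) :
  bijective f -> (forall D : {set vert G}, (f @: D \in fam H) = (D \in fam G)) ->
  exists2 g : edge (simplify G) -> edge (simplify H),
    injective g & forall e, ends (g e) = f @: ends e.
Proof.
move=> bf fE.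
have ex (e : edge (simplify G)) :
    exists e' : edge (simplify H), ends e' == f @: ends e.
  have : f @: ends (val e) \in fam H by rewrite fE mem_fam.
  by case/fam_representative => e' r ee'; exists (exist _ e' r); apply/eqP.
pose g e := xchoose (ex e).
have gE e : ends (g e) = f @: ends e by exact/eqP/(xchooseP (ex e)).
exists g => // e1 e2 e12; apply/val_inj/(representative_inj (valP e1) (valP e2)).
by apply: (imset_inj (bij_inj bf)); have := gE e1; rewrite e12 gE => ->.
Qed.

Lemma sim_isomorphic (G H : hypergraph) :
  sim G H -> isomorphic_up_to_parallel G H.
Proof.
move=> s; have [f bf fE] := s; have [f' bf' fE'] := fsim_sym s.
have [g ig gE] := sim_simplify_embedding bf fE.
have [g' ig' _] := sim_simplify_embedding bf' fE'.
exists f, g; split=> //.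
(* Injections in both directions between finite edge sets give equal cardinalities, so [g] is
   bijective. *)
by apply: inj_card_bij ig _; exact: leq_card ig'.
Qed.

(* The default [H] of [nth] is never reached, since the indices are in range. *)
Theorem theorem2p9 (H : hypergraph) (L L' : seq hypergraph)
    (Hmc : matching_covered H) (Hunif : uniformable H)
    (HL : decomposition_output H L) (HL' : decomposition_output H L') :
  size L = size L' /\
  exists phi : 'I_(size L) -> 'I_(size L'),
    bijective phi /\
    forall s : 'I_(size L),
      isomorphic_up_to_parallel (nth H L s) (nth H L' (phi s)).
Proof.
have d := output_decomp HL; have d' := output_decomp HL'.
have a : agree L L'.
  (* On one vertex every edge is a singleton and [good] fails, but no cut is nontrivial and both
     outputs are [[:: H]]. *)
  have [cV|cV] := leqP #|vert H| 1; last first.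
    by have [Z gH] := good_fam Hmc Hunif cV; exact: decomp_unique gH d d'.
  have eH : 0 < #|edge H| by case/and3P: Hmc.
  have nc := small_no_cut eH cV.
  case: d => [_|S L1 L2 nS _ _]; last by case/existsP: nc; exists S.
  case: d' => [_|S L1 L2 nS _ _]; last by case/existsP: nc; exists S.
  exact: agree_refl.
have [phi [psi [sz h1 h2 h3]]] :=
  PermutationA_nth H a (fun G => fsim_refl (fam G))
    (fun _ _ _ => @fsim_trans _ _ _ _ _ _).
split=> //.
exists (fun s : 'I_(size L) => Ordinal (h1 s (ltn_ord s)).1); split=> [|s].
  exists (fun s : 'I_(size L') => Ordinal (h2 s (ltn_ord s)).1) => s; apply: val_inj => /=.
    by case: (h1 s (ltn_ord s)).
  by case: (h2 s (ltn_ord s)).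
by apply: sim_isomorphic; exact: h3.
Qed.
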